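(* Let $P_{24}:\mathbf{R}^{24}\to\mathbf{R}$ be the cubic form $P_{24}(x)=\mathrm{Re}((o_1\cdot o_2)\cdot o_3)$, where $x=(o_1,o_2,o_3)\in\mathcal{O}^3=\mathbf{R}^{24}$. Let $1\le\delta<2$ and let $H'\subset\mathbf{R}^{24}$ be any linear subspace with $\dim H'=21$, identified with $\mathbf{R}^{21}$ by a linear isometry. Then the function $w=\big(P_{24}(x)/|x|^{\delta}\big)|_{H'}$ is a viscosity solution, in the unit ball $B\subset\mathbf{R}^{21}$, of a uniformly elliptic Isaacs equation, i.e. of an equation of the form $\sup_b\inf_a L_{ab}u=0$, where $\{L_{ab}\}$ is a two-parameter family of linear operators $L_{ab}=\sum_{i,j}a_{ij}\,\partial^2/\partial x_i\partial x_j$ whose symmetric coefficient matrices $(a_{ij})$ all satisfy $C^{-1}|\xi|^2\le\sum a_{ij}\xi_i\xi_j\le C|\xi|^2$ for all $\xi$, for one fixed constant $C>0$.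
   Context: $\mathcal{O}$ denotes the algebra of Cayley octonions: the 8-dimensional real algebra with basis $1,e_1,\dots,e_7$, where $1$ is the unit, $e_i^2=-1$, $e_ie_j=-e_je_i$ for $i\neq j$, and for every $i$ (indices mod 7) $e_ie_{i+1}=e_{i+3}$, $e_{i+1}e_{i+3}=e_i$, $e_{i+3}e_i=e_{i+1}$ (so $e_1e_2=e_4$). $\mathbf{R}^8$ is identified with $\mathcal{O}$ via $t\mapsto t_0+t_1e_1+\dots+t_7e_7$; $\mathrm{Re}$ denotes the coefficient of $1$. Octonion multiplication satisfies $\mathrm{Re}((o_1o_2)o_3)=\mathrm{Re}(o_1(o_2o_3))$. Viscosity solutions are in the standard sense. *)

(* Defs.v *)
From HB Require Import structures.
From mathcomp Require Import all_boot all_order all_algebra.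
From mathcomp Require Import all_classical all_reals all_analysis.
Set Implicit Arguments. Unset Strict Implicit. Unset Printing Implicit Defensive.
Import Order.TTheory GRing.Theory Num.Theory.
Import numFieldNormedType.Exports.
Local Open Scope classical_set_scope.
Local Open Scope ring_scope.

Section Defs.
Variable R : realType.

(* basis index 0 is the unit 1, index k in 1..7 is e_k *)
(* (tri i n) = index of e_{i+1+n} (indices mod 7, in 1..7), for i in 0..6 *)
Definition tri (i : 'I_7) (n : nat) : nat := ((i + n) %% 7).+1.

(* (a,b,c) is a cyclic rotation of (e_i, e_{i+1}, e_{i+3}), so e_a e_b = e_c *)
Definition on_line (a b c : nat) : bool :=
  [exists i : 'I_7,
     [|| (a == tri i 0) && (b == tri i 1) && (c == tri i 3),
         (a == tri i 1) && (b == tri i 3) && (c == tri i 0)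
       | (a == tri i 3) && (b == tri i 0) && (c == tri i 1)]].

(* structure constants: e_a e_b = sum_k octc a b k e_k *)
Definition octc (a b k : 'I_8) : R :=
  if a == 0 :> nat then (b == k)%:R
  else if b == 0 :> nat then (a == k)%:R
  else if a == b then - (k == 0 :> nat)%:R
  else if on_line a b k then 1
  else if on_line b a k then -1
  else 0.

(* octonions as row vectors t_0 + t_1 e_1 + ... + t_7 e_7 *)
Definition octmul (x y : 'rV[R]_8) : 'rV[R]_8 :=
  \row_(k < 8) \sum_(a < 8) \sum_(b < 8) x 0 a * y 0 b * octc a b k.

Definition octRe (x : 'rV[R]_8) : R := x 0 0.

Definition blk (x : 'rV[R]_24) (m : nat) : 'rV[R]_8 :=
  \row_(k < 8) x 0 (inord (8 * m + k)).

Definition P24 (x : 'rV[R]_24) : R :=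
  octRe (octmul (octmul (blk x 0) (blk x 1)) (blk x 2)).

Definition enorm n (x : 'rV[R]_n) : R := Num.sqrt (\sum_(i < n) x 0 i ^+ 2).

Definition unit_ball n : set 'rV[R]_n := [set x | enorm x < 1].

Definition evec n (i : 'I_n) : 'rV[R]_n := delta_mx 0 i.

Definition pd n (i : 'I_n) (f : 'rV[R]_n -> R) : 'rV[R]_n -> R :=
  fun x => 'D_(evec i) f x.

Definition C2_on n (U : set 'rV[R]_n) (f : 'rV[R]_n -> R) : Prop :=
  forall x, U x ->
    {for x, continuous f} /\
    forall i : 'I_n,
      (forall y, U y -> derivable f y (evec i)) /\ {for x, continuous (pd i f)} /\
      forall j : 'I_n,
        (forall y, U y -> derivable (pd i f) y (evec j)) /\
        {for x, continuous (pd j (pd i f))}.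

Definition hessian n (f : 'rV[R]_n -> R) (x : 'rV[R]_n) : 'M[R]_n :=
  \matrix_(i, j) pd j (pd i f) x.

Definition visc_subsol n (F : 'M[R]_n -> R) (U : set 'rV[R]_n)
    (u : 'rV[R]_n -> R) : Prop :=
  (forall x, U x -> {for x, continuous u}) /\
  forall (phi : 'rV[R]_n -> R) (x0 : 'rV[R]_n), C2_on U phi -> U x0 ->
    (\forall y \near x0, u y - phi y <= u x0 - phi x0) ->
    0 <= F (hessian phi x0).

Definition visc_supersol n (F : 'M[R]_n -> R) (U : set 'rV[R]_n)
    (u : 'rV[R]_n -> R) : Prop :=
  (forall x, U x -> {for x, continuous u}) /\
  forall (phi : 'rV[R]_n -> R) (x0 : 'rV[R]_n), C2_on U phi -> U x0 ->
    (\forall y \near x0, u x0 - phi x0 <= u y - phi y) ->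
    F (hessian phi x0) <= 0.

Definition visc_sol n (F : 'M[R]_n -> R) (U : set 'rV[R]_n)
    (u : 'rV[R]_n -> R) : Prop :=
  visc_subsol F U u /\ visc_supersol F U u.

Definition isaacs n (Ta Tb : Type) (A : Tb -> Ta -> 'M[R]_n) (M : 'M[R]_n) : R :=
  sup (range (fun b : Tb => inf (range (fun a : Ta => \tr (A b a *m M))))).

Definition unif_elliptic n (Ta Tb : Type) (A : Tb -> Ta -> 'M[R]_n) (C : R) :=
  0 < C /\
  forall b a, (A b a)^T = A b a /\
    forall xi : 'rV[R]_n,
      C^-1 * enorm xi ^+ 2 <= (xi *m A b a *m xi^T) 0 0 <= C * enorm xi ^+ 2.

Definition isaacs_visc_sol n (U : set 'rV[R]_n) (u : 'rV[R]_n -> R) : Prop :=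
  exists (Ta Tb : Type) (A : Tb -> Ta -> 'M[R]_n) (C : R),
    inhabited Ta /\ inhabited Tb /\ unif_elliptic A C /\ visc_sol (isaacs A) U u.

End Defs.

(* Main.v *)
Require Import Defs.
From HB Require Import structures.
From mathcomp Require Import all_boot all_order all_algebra.
From mathcomp Require Import all_classical all_reals all_analysis.
From mathcomp Require Import zify ring lra.
Set Implicit Arguments. Unset Strict Implicit. Unset Printing Implicit Defensive.
Import Order.TTheory GRing.Theory Num.Theory.
Import numFieldNormedType.Exports.
Local Open Scope classical_set_scope.
Local Open Scope ring_scope.

(** Write [P] for the cubic form, [w = P / |x|^delta] and [M p = |p|^delta D^2 w(p)],
    which is odd and homogeneous of degree 1 in [p].  It suffices to find, for all
    [a] and [b], a uniformly elliptic [A b a] with [tr (A b a M a) = tr (A b a M b) = 0]: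
    then [sup_b inf_a tr (A b a D^2 w(c)) = 0] for every [c], since [b = c] gives the
    value [0] and [a = c] bounds every infimum by [0].  At the origin a test function
    touching the odd function [w] has a semidefinite Hessian.

    By duality such an [A b a] exists once every [M p + M q] is uniformly indefinite
    relative to [v = p + q].  On the orthogonal complement of [p] and [q] this form is
    [D^2 P(v) - delta (h p + h q)] with [h = P / |x|^2].  Octonion algebra gives a
    7-dimensional space on which [D^2 P(v)] is (almost) at least the largest root [T]
    of [T^3 - |v|^2 T + 2 P(v)], and 5 linear conditions cut out the 19-dimensional
    space of vectors of [H'] orthogonal to [p] and [q].  It remains to see that
    [2 (h p + h q) <= T].  The roots [l_k] of the cubics attached to the points of the
    line [p - t v] satisfy Weyl type inequalities, so otherwise
    [l_k(p) + l_(4-k)(q) <= 2 (h p + h q)] for [k = 1, 2, 3]; as [2 h = l - l^3 / |x|^2]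
    for each root [l], this reads [l_k(p)^3 / |p|^2 <= - l_(4-k)(q)^3 / |q|^2], which
    after taking cube roots contradicts the vanishing of the sums of the roots. *)

(** * Cubics along a line *)

Section Star.
Variable R : rcfType.
Implicit Types (n d c x y : R).

(** The discriminant exceeds [(2 * a * x0 + b) ^+ 2], so both roots are real and lie on either side
    of [x0]. *)
Lemma quadratic_factor (a b c x0 : R) : 0 < a -> a * x0 ^+ 2 + b * x0 + c < 0 ->
  exists t1 t2, [/\ t1 < x0, x0 < t2 &
    forall t, a * t ^+ 2 + b * t + c = a * ((t - t1) * (t - t2))].
Proof.
move=> a0 neg; pose D := b ^+ 2 - 4 * a * c.
have ineq : (2 * a * x0 + b) ^+ 2 < D by rewrite /D; nra.
have D0 : 0 <= D by apply/ltW/(le_lt_trans _ ineq)/sqr_ge0.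
have sD := sqr_sqrtr D0; set s := Num.sqrt D in sD.
have s0 : 0 <= s by exact: sqrtr_ge0.
have a2 : 0 < 2 * a by lra.
have aN : a != 0 by rewrite gt_eqF.
have /andP[l1 l2] : - s < 2 * a * x0 + b < s.
  by rewrite -ltr_norml -ltr_sqr ?nnegrE// real_normK ?num_real// sD.
exists ((- b - s) / (2 * a)), ((- b + s) / (2 * a)); split.
- by rewrite ltr_pdivrMr//; lra.
- by rewrite ltr_pdivlMr//; lra.
- move=> t.
  have -> : c = (b ^+ 2 - s ^+ 2) / (4 * a) by rewrite sD /D; field.
  by field.
Qed.

Lemma cubic_ivt (n d a b : R) : a <= b ->
  (a ^+ 3 - n * a + 2 * d) * (b ^+ 3 - n * b + 2 * d) < 0 ->
  exists2 x, a < x < b & x ^+ 3 - n * x + 2 * d = 0.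
Proof.
move=> ab neg.
pose p : {poly R} := 'X^3 - n *: 'X + (2 * d)%:P.
have pE x : p.[x] = x ^+ 3 - n * x + 2 * d by rewrite !hornerE.
have key (q : {poly R}) : q.[a] < 0 -> 0 < q.[b] -> exists2 x, a < x < b & root q x.
  move=> qa qb; have [|x /andP[ax xb] rx] := @poly_ivt _ q a b ab.
    by rewrite !ltW.
  exists x => //; rewrite !lt_neqAle ax xb !andbT; apply/andP; split.
  - by apply: contraTneq rx => <-; rewrite /root lt_eqF.
  - by apply: contraTneq rx => ->; rewrite /root gt_eqF.
have [a0|a0|a0] := ltrgtP p.[a] 0.
- have [||x xab /rootP] := key p => //; first by rewrite -!pE nmulr_rlt0 in neg.
  by rewrite pE => px; exists x.
- have [||x xab] := key (- p); rewrite ?hornerN ?oppr_lt0 ?oppr_gt0//.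
    by rewrite -!pE pmulr_rlt0 in neg.
  by rewrite rootN => /rootP; rewrite pE => px; exists x.
- by rewrite -!pE a0 mul0r ltxx in neg.
Qed.

(** With [s = sqrt (n / 3)] the hypothesis reads [|d| < s ^ 3], so the values at [- 2 s], [- s],
    [s], [2 s] alternate in sign and each interval between them contains a root. *)
Lemma cubic_three_roots n d : 0 < n -> 27 * d ^+ 2 < n ^+ 3 ->
  exists l1 l2 l3, [/\ l1 + l2 + l3 = 0,
   [/\ l1 ^+ 3 - n * l1 + 2 * d = 0, 0 < l1 & n < 3 * l1 ^+ 2],
   [/\ l2 ^+ 3 - n * l2 + 2 * d = 0 & 3 * l2 ^+ 2 < n] &
   [/\ l3 ^+ 3 - n * l3 + 2 * d = 0, l3 < 0 & n < 3 * l3 ^+ 2]].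
Proof.
move=> n0 hd; pose s := Num.sqrt (n / 3).
have s0 : 0 < s by rewrite sqrtr_gt0; lra.
have sn : n = 3 * s ^+ 2 by rewrite sqr_sqrtr; [field|lra].
have s3 : 0 < s ^+ 3 by rewrite exprn_gt0.
have /andP[dl du] : - s ^+ 3 < d < s ^+ 3.
  rewrite -ltr_norml -ltr_sqr ?nnegrE// ?(ltW s3)// real_normK ?num_real//.
  move: hd; rewrite sn; have -> : (3 * s ^+ 2) ^+ 3 = 27 * (s ^+ 3) ^+ 2 by ring.
  lra.
have vp : s ^+ 3 - n * s + 2 * d < 0.
  rewrite sn; have -> : 3 * s ^+ 2 * s = 3 * s ^+ 3 by ring.
  lra.
have vm : 0 < (- s) ^+ 3 - n * (- s) + 2 * d.
  rewrite sn; have -> : (- s) ^+ 3 - 3 * s ^+ 2 * (- s) = 2 * s ^+ 3 by ring.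
  lra.
have vp2 : 0 < (2 * s) ^+ 3 - n * (2 * s) + 2 * d.
  rewrite sn; have -> : (2 * s) ^+ 3 - 3 * s ^+ 2 * (2 * s) = 2 * s ^+ 3 by ring.
  lra.
have vm2 : (- (2 * s)) ^+ 3 - n * (- (2 * s)) + 2 * d < 0.
  rewrite sn; have -> : (- (2 * s)) ^+ 3 - 3 * s ^+ 2 * (- (2 * s)) = - (2 * s ^+ 3) by ring.
  lra.
have [||l1 /andP[l1a l1b] r1] := @cubic_ivt n d s (2 * s); [lra|by rewrite nmulr_rlt0|].
have [||l2 /andP[l2a l2b] r2] := @cubic_ivt n d (- s) s; [lra|by rewrite pmulr_rlt0|].
have [||l3 /andP[l3a l3b] r3] := @cubic_ivt n d (- (2 * s)) (- s); [lra|by rewrite nmulr_rlt0|].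
exists l1, l2, l3; split.
(* Dividing the difference of two root equations by the difference of the roots gives [e12] and
   [e13]; their own difference leaves the factor [l1 + l2 + l3]. *)
- have e12 : l1 ^+ 2 + l1 * l2 + l2 ^+ 2 = n.
    apply: (@mulfI _ (l1 - l2)); first by rewrite subr_eq0 gt_eqF//; lra.
    by lra.
  have e13 : l1 ^+ 2 + l1 * l3 + l3 ^+ 2 = n.
    apply: (@mulfI _ (l1 - l3)); first by rewrite subr_eq0 gt_eqF//; lra.
    by lra.
  apply: (@mulfI _ (l2 - l3)); first by rewrite subr_eq0 gt_eqF//; lra.
  by lra.
- by split=> //; [lra|rewrite sn; nra].
- by split=> //; rewrite sn; nra.
- by split=> //; [lra|rewrite sn; nra].
Qed.

Lemma cubic_above_root n d m x : m ^+ 3 - n * m + 2 * d = 0 -> 0 < m -> n < 3 * m ^+ 2 ->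
  m < x -> 0 < x ^+ 3 - n * x + 2 * d.
Proof.
move=> r m0 mn mx.
have -> : x ^+ 3 - n * x + 2 * d = (x - m) * (x ^+ 2 + x * m + m ^+ 2 - n) by lra.
by apply: mulr_gt0; [lra|nra].
Qed.

Lemma cubic_middle_above_root n d m x : m ^+ 3 - n * m + 2 * d = 0 -> 3 * m ^+ 2 < n ->
  3 * x ^+ 2 < n -> m < x -> x ^+ 3 - n * x + 2 * d < 0.
Proof.
move=> r mn xn mx.
have -> : x ^+ 3 - n * x + 2 * d = (x - m) * (x ^+ 2 + x * m + m ^+ 2 - n) by lra.
by rewrite pmulr_rlt0; [nra|lra].
Qed.

(** In the application [N t] and [D t] are [|p - t v|^2] and a slightly shrunk [P(p - t v)]. The
    hypotheses on [mu] place it above every root of [T^3 - n2 T - 2 d3], the cubic attached to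
    [v]. *)
Variables (n0 n1 n2 d0 d1 d2 d3 : R).
Let N t := n0 + n1 * t + n2 * t ^+ 2.
Let D t := d0 + d1 * t + d2 * t ^+ 2 + d3 * t ^+ 3.
Hypothesis N_gt0 : forall t, 0 < N t.
Hypothesis D_lt : forall t, 27 * D t ^+ 2 < N t ^+ 3.
Variable mu : R.
Hypothesis mu_gt0 : 0 < mu.
Hypothesis mu_big : n2 < 3 * mu ^+ 2.
Hypothesis chi_mu : 0 < mu ^+ 3 - n2 * mu - 2 * d3.

Let g c t := (c - t * mu) ^+ 3 - N t * (c - t * mu) + 2 * D t.

(* For a root [c] at [t = 0], [g c t = t * q t] with [q] a concave quadratic;
   its signs at the two parameters where [c - t mu = +- sqrt (N t / 3)] are
   known, which locates the sign of [g c 1]. *)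
Lemma pencil_quadratic c : g c 0 = 0 ->
  exists qa qb qc t1 t2 k, [/\ qa < 0, 0 < k, t1 * mu < c & c < t2 * mu] /\
  [/\ forall t, g c t = t * (qa * t ^+ 2 + qb * t + qc),
      forall t, 3 * (c - t * mu) ^+ 2 - N t = k * ((t - t1) * (t - t2)),
      g c t1 < 0 & 0 < g c t2].
Proof.
move: (mu_gt0) (mu_big) (chi_mu) => mu0 mub chim.
move=> gc0.
have k0 : 0 < 3 * mu ^+ 2 - n2 by rewrite subr_gt0.
have [|t1 [t2 [t1c ct2 EE]]] := @quadratic_factor (3 * mu ^+ 2 - n2)
   (- (6 * c * mu) - n1) (3 * c ^+ 2 - n0) (c / mu) k0.
  have := N_gt0 (c / mu); rewrite /N => h.
  have e : (3 * mu ^+ 2 - n2) * (c / mu) ^+ 2 + (- (6 * c * mu) - n1) * (c / mu) +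
    (3 * c ^+ 2 - n0) = - (n0 + n1 * (c / mu) + n2 * (c / mu) ^+ 2).
    by field; rewrite gt_eqF.
  by rewrite e oppr_lt0.
have E t : 3 * (c - t * mu) ^+ 2 - N t = (3 * mu ^+ 2 - n2) * ((t - t1) * (t - t2)).
  by rewrite -EE /N; ring.
rewrite ltr_pdivlMr// in t1c; rewrite ltr_pdivrMr// in ct2.
have bnd t : 3 * (c - t * mu) ^+ 2 = N t -> D t ^+ 2 < ((c - t * mu) ^+ 3) ^+ 2.
  move=> e; have := D_lt t; rewrite -e.
  have -> : (3 * (c - t * mu) ^+ 2) ^+ 3 = 27 * ((c - t * mu) ^+ 3) ^+ 2 by ring.
  lra.
exists (- (mu ^+ 3 - n2 * mu - 2 * d3)),
  (3 * c * mu ^+ 2 - n2 * c + n1 * mu + 2 * d2), (- (3 * c ^+ 2 * mu) + n0 * mu - n1 * c + 2 * d1),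
  t1, t2, (3 * mu ^+ 2 - n2).
split; first by split=> //; lra.
split=> //.
- move=> t; move: gc0; rewrite /g /N /D => gc0; lra.
- have e : 3 * (c - t1 * mu) ^+ 2 = N t1 by apply/eqP; rewrite -subr_eq0 E subrr mul0r mulr0.
  have := bnd _ e; rewrite /g -e; set T := c - t1 * mu => hb.
  have T0 : 0 < T by rewrite /T; lra.
  have T3 : 0 < T ^+ 3 by rewrite exprn_gt0.
  have : D t1 < T ^+ 3 by nra.
  have -> : T ^+ 3 - 3 * T ^+ 2 * T = - 2 * T ^+ 3 by ring.
  lra.
- have e : 3 * (c - t2 * mu) ^+ 2 = N t2 by apply/eqP; rewrite -subr_eq0 E subrr !mulr0.
  have := bnd _ e; rewrite /g -e; set T := c - t2 * mu => hb.
  have T0 : 0 < - T by rewrite /T; lra.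
  have T3 : 0 < (- T) ^+ 3 by rewrite exprn_gt0.
  have e3 : (- T) ^+ 3 = - T ^+ 3 by ring.
  have : T ^+ 3 < D t2 by rewrite e3 in T3; nra.
  have -> : T ^+ 3 - 3 * T ^+ 2 * T = - 2 * T ^+ 3 by ring.
  lra.
Qed.

(** The chord inequality for a concave function; the defect is [- qa (z - y) (y - x) (z - x)]. *)
Lemma concave_quadratic (qa qb qc x y z : R) : qa < 0 -> x <= y -> y <= z ->
  (z - y) * (qa * x ^+ 2 + qb * x + qc) + (y - x) * (qa * z ^+ 2 + qb * z + qc) <=
  (z - x) * (qa * y ^+ 2 + qb * y + qc).
Proof.
move=> qa0 xy yz; pose q t := qa * t ^+ 2 + qb * t + qc.
rewrite -/(q x) -/(q y) -/(q z).
have -> : (z - x) * q y = (z - y) * q x + (y - x) * q z +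
   - qa * ((z - y) * ((y - x) * (z - x))) by rewrite /q; ring.
by rewrite lerDl mulr_ge0//; [lra|rewrite !mulr_ge0//; lra].
Qed.

(** If [c - mu] exceeded [m], then [g c 1 > 0] and both [t1] and [t2] would exceed [1]; the
    quadratic [q] would have signs [+, -, +] at [1 < t1 < t2], against concavity. *)
Lemma pencil_top c m : g c 0 = 0 -> 0 < c -> N 0 < 3 * c ^+ 2 ->
  m ^+ 3 - N 1 * m + 2 * D 1 = 0 -> 0 < m -> N 1 < 3 * m ^+ 2 ->
  c - mu <= m.
Proof.
move: (mu_gt0) (mu_big) (chi_mu) => mu0 mub chim.
move=> gc0 c0 cN rm m0 mN; rewrite leNgt; apply/negP => lt.
have [qa [qb [qc [t1 [t2 [k [[qa0 k0 h1 h2] [gE EE g1 g2]]]]]]]] := pencil_quadratic gc0.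
have t12 : t1 < t2 by rewrite -(ltr_pM2r mu_gt0); lra.
have gp : 0 < g c 1 by rewrite /g mul1r; exact: cubic_above_root rm _ _ lt.
have E0 : 0 < t1 * t2.
  rewrite -(pmulr_rgt0 _ k0).
  by have := EE 0; rewrite mul0r subr0 !sub0r mulrNN => <-; lra.
have t2p : 0 < t2 by rewrite -(pmulr_lgt0 _ mu_gt0); lra.
have t1p : 0 < t1 by rewrite -(pmulr_lgt0 _ t2p).
have E1 : 0 < (1 - t1) * (1 - t2).
  rewrite -(pmulr_rgt0 _ k0) -EE mul1r subr_gt0; nra.
have t21 : 0 < t2 - 1 by rewrite -(pmulr_lgt0 _ mu_gt0); lra.
have t11 : 0 < t1 - 1 by rewrite -(pmulr_lgt0 _ t21); lra.
rewrite !gE in gp g1 g2.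
rewrite mul1r in gp; rewrite pmulr_rlt0// in g1; rewrite pmulr_rgt0// in g2.
have l1 : 1 <= t1 by lra.
have l2 : t1 <= t2 by lra.
have := concave_quadratic qb qc qa0 l1 l2.
set q1 := qa * 1 ^+ 2 + _ + _ in gp *; set q2 := qa * t2 ^+ 2 + _ + _ in g2 *.
set q3 := qa * t1 ^+ 2 + _ + _ in g1 *; nra.
Qed.

(** Here [t1 < 0 < t2], and the contradictory signs [+, -, +] of [q] occur at [t1 < 1 < t2]. *)
Lemma pencil_middle c m : g c 0 = 0 -> 3 * c ^+ 2 < N 0 ->
  m ^+ 3 - N 1 * m + 2 * D 1 = 0 -> 3 * m ^+ 2 < N 1 ->
  c - mu <= m.
Proof.
move: (mu_gt0) (mu_big) (chi_mu) => mu0 mub chim.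
move=> gc0 cN rm mN; rewrite leNgt; apply/negP => lt.
have [qa [qb [qc [t1 [t2 [k [[qa0 k0 h1 h2] [gE EE g1 g2]]]]]]]] := pencil_quadratic gc0.
have t12 : t1 < t2 by rewrite -(ltr_pM2r mu_gt0); lra.
have E0 : t1 * t2 < 0.
  rewrite -(pmulr_rlt0 _ k0).
  by have := EE 0; rewrite mul0r subr0 !sub0r mulrNN => <-; lra.
have t1n : t1 < 0 by nra.
have t2p : 0 < t2 by nra.
have xN : 3 * (c - mu) ^+ 2 < N 1.
  (* If [t2 <= 1] then [m < c - mu < 0], so the bound on [m ^+ 2] passes to [(c - mu) ^+ 2]. *)
  case: (ltP 1 t2) => [lt2|le2].
    have : k * ((1 - t1) * (1 - t2)) < 0 by rewrite pmulr_rlt0//; nra.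
    by rewrite -EE mul1r; lra.
  have cmu : c - mu < 0 by nra.
  nra.
have gn : g c 1 < 0 by rewrite /g mul1r; exact: cubic_middle_above_root rm _ _ lt.
have t21 : 1 < t2.
  have : k * ((1 - t1) * (1 - t2)) < 0 by rewrite -EE mul1r; lra.
  by rewrite pmulr_rlt0// pmulr_rlt0; lra.
rewrite !gE in gn g1 g2.
rewrite mul1r in gn; rewrite nmulr_rlt0// in g1; rewrite pmulr_rgt0// in g2.
have l1 : t1 <= 1 by lra.
have l2 : 1 <= t2 by lra.
have := concave_quadratic qb qc qa0 l1 l2.
set q1 := qa * 1 ^+ 2 + _ + _ in gn *; set q2 := qa * t2 ^+ 2 + _ + _ in g2 *.
set q3 := qa * t1 ^+ 2 + _ + _ in g1 *; nra.
Qed.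

(** Here both [t1] and [t2] are negative, and the contradictory signs [+, -, +] of [q] occur at
    [t1 < t2 < 1]. *)
Lemma pencil_bottom c m : g c 0 = 0 -> c < 0 -> N 0 < 3 * c ^+ 2 ->
  m ^+ 3 - N 1 * m + 2 * D 1 = 0 -> m < 0 -> N 1 < 3 * m ^+ 2 ->
  c - mu <= m.
Proof.
move: (mu_gt0) (mu_big) (chi_mu) => mu0 mub chim.
move=> gc0 c0 cN rm m0 mN.
rewrite leNgt; apply/negP => lt.
have [qa [qb [qc [t1 [t2 [k [[qa0 k0 h1 h2] [gE EE g1 g2]]]]]]]] := pencil_quadratic gc0.
have t12 : t1 < t2 by rewrite -(ltr_pM2r mu_gt0); lra.
have E0 : 0 < t1 * t2.
  rewrite -(pmulr_rgt0 _ k0).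
  by have := EE 0; rewrite mul0r subr0 !sub0r mulrNN => <-; lra.
have t1n : t1 < 0 by rewrite -(pmulr_llt0 _ mu_gt0); lra.
have t2n : t2 < 0 by rewrite -(nmulr_rgt0 _ t1n).
have E1 : N 1 < 3 * (c - mu) ^+ 2.
  have : 0 < k * ((1 - t1) * (1 - t2)) by rewrite !pmulr_rgt0; lra.
  by rewrite -EE mul1r subr_gt0.
have gp : 0 < g c 1.
  rewrite /g mul1r.
  have -> : (c - mu) ^+ 3 - N 1 * (c - mu) + 2 * D 1 =
     (c - mu - m) * ((c - mu) ^+ 2 + (c - mu) * m + m ^+ 2 - N 1) by lra.
  by apply: mulr_gt0; [lra|nra].
rewrite !gE in gp g1 g2.
rewrite mul1r in gp; rewrite nmulr_rlt0// in g1; rewrite nmulr_rgt0// in g2.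
have l1 : t1 <= t2 by lra.
have l2 : t2 <= 1 by lra.
have := concave_quadratic qb qc qa0 l1 l2.
set q1 := qa * 1 ^+ 2 + _ + _ in gp *; set q2 := qa * t2 ^+ 2 + _ + _ in g2 *.
set q3 := qa * t1 ^+ 2 + _ + _ in g1 *; nra.
Qed.

Lemma cube_root (x : R) : 0 < x -> exists2 r, 0 < r & r ^+ 3 = x.
Proof.
move=> x0; have [||r /andP[r0 _] e] := @cubic_ivt 0 (- x / 2) 0 (1 + x); [lra| |].
  rewrite expr0n/= !mul0r subr0 add0r.
  have -> : 2 * (- x / 2) = - x by field.
  rewrite subr0 nmulr_rlt0 ?oppr_lt0// subr_gt0.
  by nra.
by exists r => //; apply/eqP; rewrite -subr_eq0 -e; apply/eqP; field.
Qed.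

Lemma ltr_cube (x y : R) : x < y -> x ^+ 3 < y ^+ 3.
Proof.
move=> xy; rewrite -subr_gt0.
have -> : y ^+ 3 - x ^+ 3 = (y - x) * (x ^+ 2 + x * y + y ^+ 2) by ring.
have h1 : 0 < (y - x) ^+ 2 by rewrite exprn_gt0// subr_gt0.
have h2 : 0 <= (x + y) ^+ 2 by exact: sqr_ge0.
by apply: mulr_gt0; lra.
Qed.

(* At the critical exponent [2], the three inequalities [l + k <= mu] read
   [l ^ 3 / N 0 + k ^ 3 / N 1 <= 0]; taking cube roots and using that both
   triples of roots have sum [0] forces equality everywhere. *)
Lemma pencil_absurd : mu = 2 * (D 0 / N 0 - D 1 / N 1) -> False.
Proof.
move=> muE; have N0 := N_gt0 0; have N1 := N_gt0 1.
have D1 : 27 * (- D 1) ^+ 2 < N 1 ^+ 3 by rewrite sqrrN.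
have [l1 [l2 [l3 [ls [rl1 l1p l1N] [rl2 l2N] [rl3 l3n l3N]]]]] :=
  cubic_three_roots N0 (D_lt 0).
have [k1 [k2 [k3 [ks [rk1 k1p k1N] [rk2 k2N] [rk3 k3n k3N]]]]] :=
  cubic_three_roots N1 D1.
(* The [k]'s are roots for [- D 1], so their opposites are roots for [D 1] in reversed order: the
   top root [l1] is paired with [- k3]. *)
have rkN k : k ^+ 3 - N 1 * k + 2 * (- D 1) = 0 -> (- k) ^+ 3 - N 1 * (- k) + 2 * D 1 = 0.
  by move=> e; rewrite -(oppr0 R) -e; ring.
have g0 l : l ^+ 3 - N 0 * l + 2 * D 0 = 0 -> g l 0 = 0 by rewrite /g mul0r subr0.
have i1 : l1 - mu <= - k3.
  by apply: pencil_top; rewrite ?sqrrN ?oppr_gt0//; [exact: g0|exact: rkN].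
have i2 : l2 - mu <= - k2.
  by apply: pencil_middle; rewrite ?sqrrN//; [exact: g0|exact: rkN].
have i3 : l3 - mu <= - k1.
  by apply: pencil_bottom; rewrite ?sqrrN ?oppr_lt0//; [exact: g0|exact: rkN].
(* Scaling by [r], where [r ^ 3 = N 0 / N 1], makes the two cubes comparable under one
   denominator. *)
have [r r0 r3] := cube_root (divr_gt0 N0 N1).
have NE : N 0 = r ^+ 3 * N 1 by rewrite r3 divfK// gt_eqF.
have cmp l k : l ^+ 3 - N 0 * l + 2 * D 0 = 0 -> k ^+ 3 - N 1 * k + 2 * (- D 1) = 0 ->
    l - mu <= - k -> l <= - r * k.
  move=> el ek lk.
  have dl : 2 * (D 0 / N 0) = l - l ^+ 3 / N 0.
    have -> : D 0 = (N 0 * l - l ^+ 3) / 2 by lra.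
    by field; rewrite gt_eqF.
  have dk : 2 * (D 1 / N 1) = - (k - k ^+ 3 / N 1).
    have -> : D 1 = - (N 1 * k - k ^+ 3) / 2 by lra.
    by field; rewrite gt_eqF.
  have : l ^+ 3 / N 0 + k ^+ 3 / N 1 <= 0.
    rewrite (_ : _ + _ = l + k - mu); last by rewrite muE mulrBr dl dk; ring.
    by move: lk; rewrite -subr_ge0 -oppr_ge0 (_ : - k - _ = - (l + k - mu)); [|ring].
  have -> : k ^+ 3 / N 1 = (r * k) ^+ 3 / N 0 by rewrite NE; field; rewrite !gt_eqF.
  rewrite -mulrDl pmulr_lle0 ?invr_gt0// => le3; rewrite mulNr.
  rewrite leNgt; apply/negP => ltl.
  have : (- (r * k)) ^+ 3 < l ^+ 3 by exact: ltr_cube.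
  by rewrite (_ : (- (r * k)) ^+ 3 = - (r * k) ^+ 3); [lra|ring].
have j1 := cmp _ _ rl1 rk3 i1; have j2 := cmp _ _ rl2 rk2 i2; have j3 := cmp _ _ rl3 rk1 i3.
have rks : r * k1 + r * k2 + r * k3 = 0 by rewrite -!mulrDr ks mulr0.
(* Equality [l = - r k] cancels the cubic terms and leaves [mu = l + k]; the three pairs then add up
   to [3 mu = 0]. *)
have sum0 l k : l ^+ 3 - N 0 * l + 2 * D 0 = 0 -> k ^+ 3 - N 1 * k + 2 * (- D 1) = 0 ->
    l = - r * k -> mu = l + k.
  move=> el ek lk; rewrite muE.
  have -> : D 0 = (N 0 * l - l ^+ 3) / 2 by lra.
  have -> : D 1 = - (N 1 * k - k ^+ 3) / 2 by lra.
  by rewrite lk NE; field; rewrite !gt_eqF.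
have e1 := sum0 _ _ rl1 rk3 ltac:(lra).
have e2 := sum0 _ _ rl2 rk2 ltac:(lra).
have e3 := sum0 _ _ rl3 rk1 ltac:(lra).
by have := mu_gt0; rewrite -(pmulr_rgt0 _ (ltr0n R 3)); lra.
Qed.

End Star.

(** * Octonions *)

(** A form of [on_line] over a list of naturals, which evaluates by computation. *)
Definition on_lineb (a b c : nat) : bool :=
  has (fun i =>
     [|| (a == ((i + 0) %% 7).+1) && (b == ((i + 1) %% 7).+1) && (c == ((i + 3) %% 7).+1),
         (a == ((i + 1) %% 7).+1) && (b == ((i + 3) %% 7).+1) && (c == ((i + 0) %% 7).+1)
       | (a == ((i + 3) %% 7).+1) && (b == ((i + 0) %% 7).+1) && (c == ((i + 1) %% 7).+1)])
  (iota 0 7).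

Lemma on_lineE a b c : on_line a b c = on_lineb a b c.
Proof.
apply/existsP/hasP => [[i h]|[i]].
  by exists (i : nat) => //; rewrite mem_iota /=.
by rewrite mem_iota => /= i7 h; exists (Ordinal i7).
Qed.

(* [Some true] stands for [-1], [Some false] for [1] and [None] for [0]. *)
Definition oct_sign (a b k : nat) : option bool :=
  if a == 0%N then (if b == k then Some false else None)
  else if b == 0%N then (if a == k then Some false else None)
  else if a == b then (if k == 0%N then Some true else None)
  else if on_lineb a b k then Some false
  else if on_lineb b a k then Some true
  else None.

(* [e_a e_b = +- e_k] for exactly one [b], namely [oct_col a k]. *)
Definition oct_col (a k : nat) : nat := find (fun b => oct_sign a b k) (iota 0 8).

Definition oct_neg (a k : nat) : bool := oct_sign a (oct_col a k) k == Some true.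

(** A finite check over all [8 ^ 3] triples of indices. *)
Lemma oct_colP (a b k : nat) : (a < 8)%N -> (b < 8)%N -> (k < 8)%N ->
  (oct_col a k < 8)%N /\
  oct_sign a b k = if b == oct_col a k then Some (oct_neg a k) else None.
Proof.
move=> a8 b8 k8.
have : all (fun a => all (fun b => all (fun k => (oct_col a k < 8)%N &&
  (oct_sign a b k == if b == oct_col a k then Some (oct_neg a k) else None))
  (iota 0 8)) (iota 0 8)) (iota 0 8) by vm_compute.
move=> /allP/(_ a); rewrite mem_iota => /(_ a8).
move=> /allP/(_ b); rewrite mem_iota => /(_ b8).
by move=> /allP/(_ k); rewrite mem_iota => /(_ k8)/andP[? /eqP ?].
Qed.

Lemma forall_ord8 (P : 'I_8 -> Prop) : P (inord 0) -> P (inord 1) -> P (inord 2) ->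
  P (inord 3) -> P (inord 4) -> P (inord 5) -> P (inord 6) -> P (inord 7) -> forall k, P k.
Proof.
move=> ? ? ? ? ? ? ? ? k; rewrite -(inord_val k).
by case: k => [[|[|[|[|[|[|[|[|?]]]]]]]]].
Qed.

Section Octonions.
Variable R : realType.
Implicit Types x y z : 'rV[R]_8.

Lemma octcE (a b k : 'I_8) : octc R a b k =
  if b == inord (oct_col a k) :> 'I_8 then (-1) ^+ oct_neg a k else 0.
Proof.
have [c8 oE] := oct_colP (ltn_ord a) (ltn_ord b) (ltn_ord k).
rewrite -(inj_eq val_inj) /= inordK//.
transitivity (if oct_sign a b k is Some s then (-1) ^+ s else 0 : R); last first.
  by rewrite oE; case: ifP.
rewrite /octc /oct_sign !on_lineE -!(inj_eq val_inj) /=.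
by repeat case: ifP => _ //=; rewrite ?oppr0 ?expr1 ?expr0.
Qed.

Lemma octmulE x y (k : 'I_8) : octmul x y 0 k =
  \sum_(a < 8) (-1) ^+ oct_neg a k * (x 0 a * y 0 (inord (oct_col a k))).
Proof.
rewrite mxE; apply: eq_bigr => a _.
rewrite (bigD1 (inord (oct_col a k)))//= octcE eqxx big1 => [|b bN].
  by rewrite addr0 mulrC.
by rewrite octcE (negbTE bN) mulr0.
Qed.

Lemma sum_ord8 (F : 'I_8 -> R) : \sum_i F i = F (inord 0) + F (inord 1) + F (inord 2) +
  F (inord 3) + F (inord 4) + F (inord 5) + F (inord 6) + F (inord 7).
Proof.
transitivity (\sum_(i < 8) F (inord i)); first by apply: eq_bigr => i _; rewrite inord_val.
by rewrite !big_ord_recr big_ord0 /= add0r.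
Qed.

Ltac oct_eval := repeat (match goal with
  | |- context [oct_col ?a ?k] =>
     let v := eval vm_compute in (oct_col a k) in change (oct_col a k) with v
  | |- context [oct_neg ?a ?k] =>
     let v := eval vm_compute in (oct_neg a k) in change (oct_neg a k) with v
  end).

Notation cf x i := (x 0 (inord i)).

Lemma octmul_coord x y k : (k < 8)%N -> octmul x y 0 (inord k) =
  (-1) ^+ oct_neg 0 k * (cf x (0) * cf y (oct_col 0 k)) +
  (-1) ^+ oct_neg 1 k * (cf x (1) * cf y (oct_col 1 k)) +
  (-1) ^+ oct_neg 2 k * (cf x (2) * cf y (oct_col 2 k)) +
  (-1) ^+ oct_neg 3 k * (cf x (3) * cf y (oct_col 3 k)) +
  (-1) ^+ oct_neg 4 k * (cf x (4) * cf y (oct_col 4 k)) +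
  (-1) ^+ oct_neg 5 k * (cf x (5) * cf y (oct_col 5 k)) +
  (-1) ^+ oct_neg 6 k * (cf x (6) * cf y (oct_col 6 k)) +
  (-1) ^+ oct_neg 7 k * (cf x (7) * cf y (oct_col 7 k)).
Proof. by move=> k8; rewrite octmulE sum_ord8 !inordK. Qed.

Definition octconj x : 'rV[R]_8 := \row_k (if k == 0 :> nat then x 0 k else - x 0 k).

Lemma octconj0 x : octconj x 0 (inord 0) = cf x (0).
Proof. by rewrite mxE inordK. Qed.

Lemma octconjS x k : (k < 7)%N -> octconj x 0 (inord k.+1) = - cf x (k.+1).
Proof. by move=> k8; rewrite mxE inordK. Qed.

Definition dot n (x y : 'rV[R]_n) : R := \sum_i x 0 i * y 0 i.

Definition oct_tri x y z := octRe (octmul (octmul x y) z).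

Definition octE := (octconj0, octconjS).

Lemma oct_triE x y z : oct_tri x y z = dot (octconj (octmul x y)) z.
Proof.
rewrite /oct_tri /octRe /dot sum_ord8.
have -> : (0 : 'I_8) = inord 0 by apply/val_inj; rewrite /= inordK.
rewrite !octE// octmul_coord//.
by oct_eval; rewrite !expr0 !expr1; ring.
Qed.

Lemma oct_tri_cycle x y z : oct_tri x y z = oct_tri y z x.
Proof.
rewrite !oct_triE /dot !sum_ord8 !octE// !octmul_coord//.
by oct_eval; rewrite !expr0 !expr1; ring.
Qed.

(** The composition law [|x y| = |x| |y|], polarized in the right factor; verified in
    coordinates. *)
Lemma dot_octmul_l x y z : dot (octmul x y) (octmul x z) = dot x x * dot y z.
Proof.
rewrite /dot !sum_ord8 !octmul_coord//.
by oct_eval; rewrite !expr0 !expr1; ring.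
Qed.

Lemma dot_octconj x y : dot (octconj x) (octconj y) = dot x y.
Proof. by rewrite /dot !sum_ord8 !octE//; ring. Qed.

(** The polarization in [x] of the alternative law [x (conj x conj z) = |x|^2 conj z]. For
    orthogonal [x] and [y] it is an anticommutation rule. *)
Lemma octmul_clifford x y z :
  octconj (octmul x (octconj (octmul z y))) + octconj (octmul y (octconj (octmul z x))) =
  (2 * dot x y) *: z.
Proof.
apply/rowP; apply: forall_ord8.
all: rewrite [LHS]mxE [RHS]mxE !octE// !octmul_coord//; oct_eval.
all: rewrite !octE// !octmul_coord// /dot !sum_ord8; oct_eval.
all: rewrite !expr0 !expr1; ring.
Qed.

End Octonions.

(** * Trial vectors *)

Section Dot.
Variables (R : realType) (n : nat).
Implicit Types (x y z : 'rV[R]_n) (a : R).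

Lemma dotC x y : dot x y = dot y x.
Proof. by apply: eq_bigr => i _; rewrite mulrC. Qed.

Lemma dotDl x y z : dot (x + y) z = dot x z + dot y z.
Proof. by rewrite -big_split; apply: eq_bigr => i _; rewrite mxE mulrDl. Qed.

Lemma dotZl a x y : dot (a *: x) y = a * dot x y.
Proof. by rewrite /dot mulr_sumr; apply: eq_bigr => i _; rewrite mxE mulrA. Qed.

Lemma dotDr x y z : dot x (y + z) = dot x y + dot x z.
Proof. by rewrite dotC dotDl !(dotC x). Qed.

Lemma dotZr a x y : dot x (a *: y) = a * dot x y.
Proof. by rewrite dotC dotZl dotC. Qed.

Lemma dotNl x y : dot (- x) y = - dot x y.
Proof. by rewrite -scaleN1r dotZl mulN1r. Qed.

Lemma dotNr x y : dot x (- y) = - dot x y.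
Proof. by rewrite dotC dotNl dotC. Qed.

Lemma dot0l x : dot 0 x = 0.
Proof. by rewrite -(scale0r 0) dotZl mul0r. Qed.

Lemma dot_ge0 x : 0 <= dot x x.
Proof. by apply: sumr_ge0 => i _; rewrite -expr2 sqr_ge0. Qed.

Lemma dot_eq0 x : (dot x x == 0) = (x == 0).
Proof.
apply/eqP/eqP => [/eqP|->]; last by rewrite dot0l.
rewrite psumr_eq0 => [/allP h|i _]; last by rewrite -expr2 sqr_ge0.
apply/rowP => i; have := h i; rewrite mem_index_enum => /(_ isT)/eqP/eqP.
by rewrite -expr2 sqrf_eq0 mxE => /eqP.
Qed.

Lemma dot_gt0 x : x != 0 -> 0 < dot x x.
Proof. by move=> x0; rewrite lt0r dot_eq0 x0 dot_ge0. Qed.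

Lemma enorm_dot x : enorm x = Num.sqrt (dot x x).
Proof. by congr Num.sqrt; apply: eq_bigr => i _; rewrite expr2. Qed.

Lemma enorm_sqr x : enorm x ^+ 2 = dot x x.
Proof. by rewrite enorm_dot sqr_sqrtr// dot_ge0. Qed.

Lemma dot_cauchy x y : dot x y ^+ 2 <= dot x x * dot y y.
Proof.
have [->|y0] := eqVneq y 0; first by rewrite dotC !dot0l mulr0 expr0n.
have Y0 := dot_gt0 y0.
have := dot_ge0 (dot y y *: x - dot x y *: y).
rewrite !(dotDl, dotDr, dotZl, dotZr, dotNl, dotNr) (dotC y x).
set a := dot x x; set b := dot x y; set c := dot y y.
rewrite (_ : _ + _ = c * (a * c - b ^+ 2)); last by ring.
by rewrite pmulr_rge0// subr_ge0.
Qed.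

Lemma dot_mx x y : dot x y = (x *m y^T) 0 0.
Proof. by rewrite mxE; apply: eq_bigr => i _; rewrite mxE. Qed.

End Dot.

(** * Kernel vectors by counting dimensions *)

Section LinearCount.
Variable R : realType.

Lemma linear_rV_mx m n (f : 'rV[R]_m -> 'rV[R]_n) :
  (forall x y, f (x + y) = f x + f y) -> (forall a x, f (a *: x) = a *: f x) ->
  exists F : 'M[R]_(m, n), forall x, f x = x *m F.
Proof.
move=> fD fZ; exists (\matrix_i f (delta_mx 0 i)) => x.
have f0 : f 0 = 0 by rewrite -(scale0r 0) fZ scale0r.
rewrite {1}(row_sum_delta x) (big_morph f fD f0) mulmx_sum_row.
by apply: eq_bigr => i _; rewrite fZ rowK.
Qed.

Lemma exists_kernel_vec m n (F : 'M[R]_(m, n)) : (\rank F < m)%N ->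
  exists2 x : 'rV[R]_m, x != 0 & x *m F = 0.
Proof.
move=> rF; have : kermx F != 0 by rewrite -mxrank_eq0 mxrank_ker subn_eq0 -ltnNge.
case/rowV0Pn => x /sub_kermxP xF x0; by exists x.
Qed.

End LinearCount.

(** * Approximate eigenvectors of the Hessian of the octonionic form *)

Section Trial.
Variable R : realType.
Implicit Types x y z : 'rV[R]_8.

Lemma octmulDl x y z : octmul (x + y) z = octmul x z + octmul y z.
Proof.
apply/rowP => k; rewrite !mxE -big_split; apply: eq_bigr => a _.
by rewrite -big_split; apply: eq_bigr => b _; rewrite mxE !mulrDl.
Qed.

Lemma octmulDr x y z : octmul x (y + z) = octmul x y + octmul x z.
Proof.
apply/rowP => k; rewrite !mxE -big_split; apply: eq_bigr => a _.
by rewrite -big_split; apply: eq_bigr => b _; rewrite mxE mulrDr !mulrDl.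
Qed.

Lemma octmulZl (c : R) x y : octmul (c *: x) y = c *: octmul x y.
Proof.
apply/rowP => k; rewrite !mxE mulr_sumr; apply: eq_bigr => a _.
by rewrite mulr_sumr; apply: eq_bigr => b _; rewrite mxE !mulrA.
Qed.

Lemma octmulZr (c : R) x y : octmul x (c *: y) = c *: octmul x y.
Proof.
apply/rowP => k; rewrite !mxE mulr_sumr; apply: eq_bigr => a _.
by rewrite mulr_sumr; apply: eq_bigr => b _; rewrite mxE mulrCA !mulrA.
Qed.

Lemma octconjD x y : octconj (x + y) = octconj x + octconj y.
Proof. by apply/rowP => k; rewrite !mxE; case: ifP => //; rewrite opprD. Qed.

Lemma octconjZ (c : R) x : octconj (c *: x) = c *: octconj x.
Proof. by apply/rowP => k; rewrite !mxE; case: ifP => //; rewrite mulrN. Qed.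

Definition octL := (octmulDl, octmulDr, octmulZl, octmulZr, octconjD, octconjZ).

Lemma oct_tri_bound x y z : oct_tri x y z ^+ 2 <= dot x x * dot y y * dot z z.
Proof.
rewrite oct_triE; apply: le_trans (dot_cauchy _ _) _.
by rewrite dot_octconj dot_octmul_l.
Qed.

Lemma octconj_clifford1 x z : octconj (octmul x (octconj (octmul z x))) = dot x x *: z.
Proof.
have := octmul_clifford x x z; rewrite -mulr2n -scaler_nat -scalerA.
by move/(scalerI _); apply; rewrite pnatr_eq0.
Qed.

(** With [y1 = k e] the last two eigenvector equations are [T y2 = conj(o3 y1) + conj(y3 o1)] and
    [T y3 = conj(y1 o2) + conj(o1 y2)]. Eliminating one unknown puts the factor [T^2 - |o1|^2]
    before the other, and [k = T^2 - |o1|^2] cancels it. *)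
Definition trial2 (T : R) (o1 o2 o3 e : 'rV[R]_8) :=
  T *: octconj (octmul o3 e) + octconj (octmul (octconj (octmul e o2)) o1).
Definition trial3 (T : R) (o1 o2 o3 e : 'rV[R]_8) :=
  T *: octconj (octmul e o2) + octconj (octmul o1 (octconj (octmul o3 e))).

(* [((T^2 - |o1|^2) e, trial2, trial3)] solves the last two of the three octonionic
   equations [D^2 P(o) y = T y]; the defect of the first one is [- chi(T) e]. *)
Lemma trial_form (T : R) (o1 o2 o3 e : 'rV[R]_8) : dot o1 e = 0 ->
  let k := T ^+ 2 - dot o1 o1 in
  let y1 := k *: e in let y2 := trial2 T o1 o2 o3 e in let y3 := trial3 T o1 o2 o3 e in
  2 * (oct_tri y1 y2 o3 + oct_tri y1 o2 y3 + oct_tri o1 y2 y3) =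
  T * (dot y1 y1 + dot y2 y2 + dot y3 y3) -
  (T ^+ 3 - (dot o1 o1 + dot o2 o2 + dot o3 o3) * T + 2 * oct_tri o1 o2 o3) * k * dot e e.
Proof.
move=> oe k y1 y2 y3.
pose A := octconj (octmul o3 e); pose C := octconj (octmul e o2).
pose B := octconj (octmul C o1); pose D := octconj (octmul o1 A).
have y2E : y2 = T *: A + B by [].
have y3E : y3 = T *: C + D by [].
have AA : dot A A = dot o3 o3 * dot e e by rewrite dot_octconj dot_octmul_l.
have CC : dot C C = dot o2 o2 * dot e e by rewrite dot_octconj dot_octmul_l mulrC.
have BB : dot B B = dot o1 o1 * dot C C by rewrite dot_octconj dot_octmul_l mulrC.
have DD : dot D D = dot o1 o1 * dot A A by rewrite dot_octconj dot_octmul_l.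
have triA z : oct_tri e z o3 = dot A z by rewrite -oct_triE oct_tri_cycle oct_tri_cycle.
have triC z : oct_tri e o2 z = dot C z by rewrite oct_triE.
have AB : dot A B = dot C D.
  by rewrite (dotC A) (dotC C) -!oct_triE oct_tri_cycle.
have triB z : oct_tri o1 B z = dot o1 o1 * dot C z.
  by rewrite oct_triE octconj_clifford1 dotZl.
have triD z : oct_tri o1 A z = dot D z by rewrite oct_triE.
(* Orthogonality of [o1] and [e] enters here: moving [o1] past [e] only changes a sign, and the
   composition law then applies. *)
have CD : dot C D = - (oct_tri o1 o2 o3 * dot e e).
  have -> : D = - octconj (octmul e (octconj (octmul o3 o1))).
    have := octmul_clifford o1 e o3; rewrite oe mulr0 scale0r.
    by move/eqP; rewrite addr_eq0 => /eqP.
  by rewrite dotNr dot_octconj dot_octmul_l (dotC o2) -oct_triE oct_tri_cycle mulrC.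
have triZ c x y z : oct_tri (c *: x) y z = c * oct_tri x y z.
  by rewrite !oct_triE !octL dotZl.
rewrite !triZ triA triC y2E y3E.
have -> : oct_tri o1 (T *: A + B) (T *: C + D) =
    T * dot D (T *: C + D) + dot o1 o1 * dot C (T *: C + D).
  by rewrite -triD -triB !oct_triE !octL dotDl dotZl.
rewrite /y1 !(dotDl, dotDr, dotZl, dotZr) (dotC D C) (dotC B A) BB DD AB AA CC CD /k.
ring.
Qed.

End Trial.

(** * The form P24 *)

Section Blocks.
Variable R : realType.
Implicit Types (x y z v : 'rV[R]_24).

Lemma sum_ord24 (F : 'I_24 -> R) : \sum_i F i =
  \sum_(k < 8) F (inord (8 * 0 + k)) + \sum_(k < 8) F (inord (8 * 1 + k)) +
  \sum_(k < 8) F (inord (8 * 2 + k)).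
Proof.
rewrite (@big_split_ord _ _ _ 8 (8 + 8)) /= (@big_split_ord _ _ _ 8 8) /= addrA.
congr (_ + _ + _); apply: eq_bigr => k _; congr F; apply/val_inj;
  have k8 := ltn_ord k; rewrite /= inordK; lia.
Qed.

Lemma dot_blk x y : dot x y = dot (blk x 0) (blk y 0) + dot (blk x 1) (blk y 1) +
  dot (blk x 2) (blk y 2).
Proof.
by rewrite /dot sum_ord24; congr (_ + _ + _); apply: eq_bigr => k _; rewrite !mxE.
Qed.

Definition cat3 (a b c : 'rV[R]_8) : 'rV[R]_24 :=
  \row_(i < 24) (if (i < 8)%N then a 0 (inord i) else
                if (i < 16)%N then b 0 (inord (i - 8)) else c 0 (inord (i - 16))).

Lemma blk_cat3 a b c : [/\ blk (cat3 a b c) 0 = a, blk (cat3 a b c) 1 = b &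
  blk (cat3 a b c) 2 = c].
Proof.
by split; apply/rowP; apply: forall_ord8; rewrite !mxE !inordK.
Qed.

Lemma cat3D a b c a' b' c' : cat3 (a + a') (b + b') (c + c') = cat3 a b c + cat3 a' b' c'.
Proof. by apply/rowP => i; rewrite !mxE; case: ifP => // _; case: ifP. Qed.

Lemma cat3Z (s : R) a b c : cat3 (s *: a) (s *: b) (s *: c) = s *: cat3 a b c.
Proof. by apply/rowP => i; rewrite !mxE; case: ifP => // _; case: ifP. Qed.

Lemma blkD x y m : blk (x + y) m = blk x m + blk y m.
Proof. by apply/rowP => i; rewrite !mxE. Qed.

Lemma blkZ (s : R) x m : blk (s *: x) m = s *: blk x m.
Proof. by apply/rowP => i; rewrite !mxE. Qed.

(** The polarization of [P24], normalized so that [P24_tri v z z] is the second derivative of [P24]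
    at [v] along [z]. *)
Definition P24_tri x y z :=
  oct_tri (blk x 0) (blk y 1) (blk z 2) + oct_tri (blk x 0) (blk z 1) (blk y 2) +
  oct_tri (blk y 0) (blk x 1) (blk z 2) + oct_tri (blk y 0) (blk z 1) (blk x 2) +
  oct_tri (blk z 0) (blk x 1) (blk y 2) + oct_tri (blk z 0) (blk y 1) (blk x 2).

Lemma P24_triE x : P24_tri x x x = 6 * P24 x.
Proof. by rewrite /P24_tri -/(oct_tri _ _ _) /P24 -/(oct_tri _ _ _); ring. Qed.

Lemma P24_triC12 x y z : P24_tri x y z = P24_tri y x z.
Proof. by rewrite /P24_tri; ring. Qed.

Lemma P24_triC23 x y z : P24_tri x y z = P24_tri x z y.
Proof. by rewrite /P24_tri; ring. Qed.

Lemma P24_triD x x' y z : P24_tri (x + x') y z = P24_tri x y z + P24_tri x' y z.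
Proof. by rewrite /P24_tri !blkD !oct_triE !octL !(dotDl, dotDr); ring. Qed.

Lemma P24_triZ (s : R) x y z : P24_tri (s *: x) y z = s * P24_tri x y z.
Proof. by rewrite /P24_tri !blkZ !oct_triE !octL !(dotZl, dotZr); ring. Qed.

Lemma amgm3 (a b c : R) : 0 <= a -> 0 <= b -> 0 <= c -> 27 * (a * b * c) <= (a + b + c) ^+ 3.
Proof.
move=> a0 b0 c0.
have h (p q r : R) : 0 <= p -> 0 <= p * (q - r) ^+ 2 by move=> p0; rewrite mulr_ge0 ?sqr_ge0.
have := h a b c a0; have := h b a c b0; have := h c a b c0.
have := h a a b a0; have := h b a b b0; have := h a a c a0; have := h c a c c0.
have := h b b c b0; have := h c b c c0.
lra.
Qed.

(** The arithmetic-geometric mean inequality for the three block norms. The bound says that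
    [T^3 - |x|^2 T + 2 P24(x)] has nonnegative discriminant. *)
Lemma P24_bound x : 27 * P24 x ^+ 2 <= dot x x ^+ 3.
Proof.
rewrite dot_blk; apply: le_trans (amgm3 (dot_ge0 _) (dot_ge0 _) (dot_ge0 _)).
by rewrite ler_pM2l// oct_tri_bound.
Qed.

(** At [T0] itself [k] may vanish, so the trial vector is taken at [T = T0 + eps / 2]. Its defect is
    at most [3 (eps / 2) |y1|^2], which the margin [T - (T0 - eps) = 3 eps / 2] absorbs. *)
Lemma trial_lower (T0 eps : R) (o1 o2 o3 : 'rV[R]_8) (n : R) :
  n = dot o1 o1 + dot o2 o2 + dot o3 o3 -> 0 < eps -> 0 <= T0 -> n <= 3 * T0 ^+ 2 -> 3 * dot o1 o1 <= n ->
  T0 ^+ 3 - n * T0 + 2 * oct_tri o1 o2 o3 <= 0 ->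
  exists T : R, exists k : R, k != 0 /\ forall e y1 y2 y3 : 'rV[R]_8, dot o1 e = 0 ->
  y1 = k *: e -> y2 = trial2 T o1 o2 o3 e -> y3 = trial3 T o1 o2 o3 e ->
  (T0 - eps) * (dot y1 y1 + dot y2 y2 + dot y3 y3) <=
  2 * (oct_tri y1 y2 o3 + oct_tri y1 o2 y3 + oct_tri o1 y2 y3).
Proof.
move=> nE eps0 T00 T0n o1n chi0.
pose T := T0 + eps / 2; pose k := T ^+ 2 - dot o1 o1.
have k0 : 0 < k by rewrite /k /T; nra.
exists T, k; split; first by rewrite gt_eqF.
move=> e y1 y2 y3 oe y1d y2d y3d.
have := trial_form T o2 o3 oe => /=; rewrite -nE -/k -y1d -y2d -y3d => ->.
have chiT : T ^+ 3 - n * T + 2 * oct_tri o1 o2 o3 <= 3 * (eps / 2) * k.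
  rewrite /k /T.
  have -> : (T0 + eps / 2) ^+ 3 - n * (T0 + eps / 2) + 2 * oct_tri o1 o2 o3 =
    (T0 ^+ 3 - n * T0 + 2 * oct_tri o1 o2 o3) +
    eps / 2 * (3 * T0 ^+ 2 + 3 * T0 * (eps / 2) + (eps / 2) ^+ 2 - n) by field.
  have : 0 <= eps / 2 * (3 * (T0 * (eps / 2)) + 2 * (eps / 2) ^+ 2 + (n - 3 * dot o1 o1)).
    by apply: mulr_ge0; [|nra]; lra.
  by lra.
have y1E : dot y1 y1 = k ^+ 2 * dot e e by rewrite y1d dotZl dotZr expr2 mulrA.
have e0 := dot_ge0 e; have y20 := dot_ge0 y2; have y30 := dot_ge0 y3.
have := dot_ge0 y1; rewrite y1E => y10.
have : (T ^+ 3 - n * T + 2 * oct_tri o1 o2 o3) * k * dot e e <=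
   3 * (eps / 2) * k * k * dot e e.
  by rewrite ler_wpM2r// ler_wpM2r// ltW.
set X := (T ^+ 3 - _ + _) * k * dot e e.
have : 0 <= eps * dot y2 y2 by rewrite mulr_ge0// ltW.
have : 0 <= eps * dot y3 y3 by rewrite mulr_ge0// ltW.
rewrite /T; lra.
Qed.

Lemma mxrank_row_mx_le m n1 n2 (A : 'M[R]_(m, n1)) (B : 'M[R]_(m, n2)) :
  (\rank (row_mx A B) <= \rank A + \rank B)%N.
Proof.
rewrite -mxrank_tr tr_row_mx -addsmxE -(mxrank_tr A) -(mxrank_tr B).
exact: (mxrank_adds_leqif _ _).1.
Qed.

(** The map [c] assembles three octonions into a vector of [R^24] in some cyclic order of the
    blocks. Trial vectors depend linearly on [e], which has [8] coordinates, against at most [5]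
    conditions from [K] and one from [dot o1 e = 0]. *)
Lemma trial_in_kernel m (K : 'M[R]_(24, m)) v (T0 eps : R) (o1 o2 o3 : 'rV[R]_8)
    (c : 'rV[R]_8 -> 'rV[R]_8 -> 'rV[R]_8 -> 'rV[R]_24) :
  (forall a b d a' b' d', c (a + a') (b + b') (d + d') = c a b d + c a' b' d') ->
  (forall (s : R) a b d, c (s *: a) (s *: b) (s *: d) = s *: c a b d) ->
  (forall a b d, dot (c a b d) (c a b d) = dot a a + dot b b + dot d d) ->
  (forall a b d, P24_tri v (c a b d) (c a b d) =
     2 * (oct_tri a b o3 + oct_tri a o2 d + oct_tri o1 b d)) ->
  dot v v = dot o1 o1 + dot o2 o2 + dot o3 o3 -> P24 v = oct_tri o1 o2 o3 ->
  3 * dot o1 o1 <= dot v v ->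
  (\rank K <= 5)%N -> 0 < eps -> 0 <= T0 -> dot v v <= 3 * T0 ^+ 2 ->
  T0 ^+ 3 - dot v v * T0 + 2 * P24 v <= 0 ->
  exists y, [/\ y != 0, y *m K = 0 & (T0 - eps) * dot y y <= P24_tri v y y].
Proof.
move=> cD cZ cdot ctri vE PE o1v rK eps0 T00 T0v chi0.
rewrite vE in o1v T0v chi0; rewrite PE in chi0.
have [T [k [k0 hT]]] := trial_lower erefl eps0 T00 T0v o1v chi0.
pose f (e : 'rV[R]_8) : 'rV[R]_24 := c (k *: e) (trial2 T o1 o2 o3 e) (trial3 T o1 o2 o3 e).
have fD (x y : 'rV[R]_8) : f (x + y) = f x + f y.
  rewrite /f -cD; congr (c _ _ _); rewrite /trial2 /trial3 ?octL ?scalerDr//.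
    by rewrite addrACA.
  by rewrite addrACA.
have fZ a (x : 'rV[R]_8) : f (a *: x) = a *: f x.
  rewrite /f -cZ; congr (c _ _ _); rewrite /trial2 /trial3 ?octL ?scalerDr !scalerA//;
    by rewrite [(_ * a)%R]mulrC.
have [F fF] := linear_rV_mx fD fZ.
have [|e e0 eG] := @exists_kernel_vec R 8 (m + 1) (row_mx (F *m K) o1^T).
  apply: leq_ltn_trans (mxrank_row_mx_le _ _) _.
  apply: (@leq_ltn_trans (5 + 1)) => //; apply: leq_add.
    exact: leq_trans (mxrankM_maxr _ _) rK.
  exact: rank_leq_col.
move: eG; rewrite mul_mx_row -row_mx0 => /eq_row_mx[eK eo1].
have oe : dot o1 e = 0 by rewrite dotC dot_mx eo1 mxE.
exists (f e); split; last first.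
- by rewrite /f cdot ctri; apply: (hT e).
- by rewrite fF -mulmxA.
rewrite -dot_eq0 gt_eqF// /f cdot.
have : 0 < dot (k *: e) (k *: e) by rewrite dot_gt0// scaler_eq0 negb_or k0.
by have := dot_ge0 (trial2 T o1 o2 o3 e); have := dot_ge0 (trial3 T o1 o2 o3 e); lra.
Qed.

(** Some block of [v] carries at most a third of [dot v v]; cyclic symmetry of the triple product
    lets it play the role of [o1]. *)
Lemma P24_large_on_kernel m (K : 'M[R]_(24, m)) v (T0 eps : R) :
  (\rank K <= 5)%N -> 0 < eps -> 0 <= T0 -> dot v v <= 3 * T0 ^+ 2 ->
  T0 ^+ 3 - dot v v * T0 + 2 * P24 v <= 0 ->
  exists y, [/\ y != 0, y *m K = 0 & (T0 - eps) * dot y y <= P24_tri v y y].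
Proof.
move=> rK eps0 T00 T0v chi0.
have PE : P24 v = oct_tri (blk v 0) (blk v 1) (blk v 2) by [].
have [h|h|h] : [\/ 3 * dot (blk v 0) (blk v 0) <= dot v v,
    3 * dot (blk v 1) (blk v 1) <= dot v v | 3 * dot (blk v 2) (blk v 2) <= dot v v].
  rewrite dot_blk; set a := dot (blk v 0) _; set b := dot (blk v 1) _; set c := dot (blk v 2) _.
  have [?|?] := lerP (3 * a) (a + b + c); first by constructor 1.
  have [?|?] := lerP (3 * b) (a + b + c); first by constructor 2.
  by constructor 3; lra.
- apply: (@trial_in_kernel _ _ _ _ _ (blk v 0) (blk v 1) (blk v 2) cat3) => //.
  + exact: cat3D.
  + exact: cat3Z.
  + by move=> a b d; rewrite dot_blk; have [-> -> ->] := blk_cat3 a b d.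
  + by move=> a b d; rewrite /P24_tri; have [-> -> ->] := blk_cat3 a b d; ring.
  + exact: dot_blk.
- apply: (@trial_in_kernel _ _ _ _ _ (blk v 1) (blk v 2) (blk v 0) (fun a b d => cat3 d a b)) => //.
  + by move=> *; exact: cat3D.
  + by move=> *; exact: cat3Z.
  + by move=> a b d; rewrite dot_blk; have [-> -> ->] := blk_cat3 d a b; ring.
  + move=> a b d; rewrite /P24_tri; have [-> -> ->] := blk_cat3 d a b.
    by rewrite !(oct_tri_cycle (blk v 0)) !(oct_tri_cycle d); ring.
  + by rewrite dot_blk; ring.
  + by rewrite PE oct_tri_cycle.
- apply: (@trial_in_kernel _ _ _ _ _ (blk v 2) (blk v 0) (blk v 1) (fun a b d => cat3 b d a)) => //.
  + by move=> *; exact: cat3D.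
  + by move=> *; exact: cat3Z.
  + by move=> a b d; rewrite dot_blk; have [-> -> ->] := blk_cat3 b d a; ring.
  + move=> a b d; rewrite /P24_tri; have [-> -> ->] := blk_cat3 b d a.
    by rewrite -!(oct_tri_cycle a) -!(oct_tri_cycle (blk v 2)); ring.
  + by rewrite dot_blk; ring.
  + by rewrite PE -oct_tri_cycle.
Qed.

End Blocks.

(** * Restriction to a 21-dimensional subspace *)

Section Restriction.
Variables (R : realType) (Q : 'M[R]_(21, 24)).
Hypothesis QQ : Q *m Q^T = 1%:M.

Lemma dot_isometry (x y : 'rV[R]_21) : dot (x *m Q) (y *m Q) = dot x y.
Proof. by rewrite !dot_mx trmx_mul mulmxA -(mulmxA x) QQ mulmx1. Qed.

(** The five conditions: three for membership in the row space of [Q], two for orthogonality to [a]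
    and [b]. *)
Lemma P24_large_on_subspace (v a b : 'rV[R]_21) (T0 eps : R) :
  0 < eps -> 0 <= T0 -> dot v v <= 3 * T0 ^+ 2 ->
  T0 ^+ 3 - dot v v * T0 + 2 * P24 (v *m Q) <= 0 ->
  exists z, [/\ z != 0, dot z a = 0, dot z b = 0 &
    (T0 - eps) * dot z z <= P24_tri (v *m Q) (z *m Q) (z *m Q)].
Proof.
move=> eps0 T00 T0v chi0.
pose K := row_mx (cokermx Q) (row_mx (a *m Q)^T (b *m Q)^T).
have rQ : \rank Q = 21%N.
  apply/eqP; rewrite eqn_leq rank_leq_row/=.
  by rewrite -{1}(mxrank1 R 21) -QQ mxrankM_maxl.
have rK : (\rank K <= 5)%N.
  apply: leq_trans (mxrank_row_mx_le _ _) _; rewrite mxrank_coker rQ.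
  apply: (@leq_add _ _ 3 2) => //.
  by apply: leq_trans (mxrank_row_mx_le _ _) _; apply: (@leq_add _ _ 1 1); exact: rank_leq_col.
rewrite -dot_isometry in T0v chi0.
have [y [y0 yK yP]] := P24_large_on_kernel rK eps0 T00 T0v chi0.
move: yK; rewrite !mul_mx_row -!row_mx0 => /eq_row_mx[yQ /eq_row_mx[ya yb]].
have /submxP[z zE] : (y <= Q)%MS by rewrite submxE yQ.
exists z; rewrite zE in y0 ya yb yP; split.
- by apply: contraNneq y0 => ->; rewrite mul0mx.
- by rewrite -dot_isometry dot_mx ya mxE.
- by rewrite -dot_isometry dot_mx yb mxE.
- by rewrite -dot_isometry.
Qed.

End Restriction.

(** * The inequality at the critical exponent *)

Section CubicForm.
Variables (R : realType) (n : nat) (Phi : 'rV[R]_n -> 'rV[R]_n -> 'rV[R]_n -> R).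
Implicit Types (p q v x y z : 'rV[R]_n).
Hypothesis PhiD : forall x x' y z, Phi (x + x') y z = Phi x y z + Phi x' y z.
Hypothesis PhiZ : forall (a : R) x y z, Phi (a *: x) y z = a * Phi x y z.
Hypothesis PhiC12 : forall x y z, Phi x y z = Phi y x z.
Hypothesis PhiC23 : forall x y z, Phi x y z = Phi x z y.

Definition cubic x := Phi x x x / 6.

Lemma PhiD2 x y y' z : Phi x (y + y') z = Phi x y z + Phi x y' z.
Proof. by rewrite PhiC12 PhiD !(PhiC12 x). Qed.

Lemma PhiD3 x y z z' : Phi x y (z + z') = Phi x y z + Phi x y z'.
Proof. by rewrite PhiC23 PhiD2 !(PhiC23 x y). Qed.

Lemma PhiZ2 (a : R) x y z : Phi x (a *: y) z = a * Phi x y z.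
Proof. by rewrite PhiC12 PhiZ PhiC12. Qed.

Lemma PhiZ3 (a : R) x y z : Phi x y (a *: z) = a * Phi x y z.
Proof. by rewrite PhiC23 PhiZ2 PhiC23. Qed.

Lemma cubicZ (a : R) x : cubic (a *: x) = a ^+ 3 * cubic x.
Proof. by rewrite /cubic PhiZ PhiZ2 PhiZ3; field. Qed.

Lemma cubicN x : cubic (- x) = - cubic x.
Proof. by rewrite -scaleN1r cubicZ; ring. Qed.

Lemma cubic0 : cubic 0 = 0.
Proof. by rewrite -(scale0r 0) cubicZ expr0n/= mul0r. Qed.

Lemma cubic_line x z (t : R) : cubic (x + t *: z) =
  cubic x + Phi x x z / 2 * t + Phi x z z / 2 * t ^+ 2 + cubic z * t ^+ 3.
Proof.
rewrite /cubic !(PhiD, PhiD2, PhiD3, PhiZ, PhiZ2, PhiZ3).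
rewrite (PhiC12 z x x) (PhiC23 x z x) (PhiC12 z x z) (PhiC23 z z x) (PhiC12 z x z).
by field.
Qed.

Lemma dot_line x z (t : R) : dot (x + t *: z) (x + t *: z) =
  dot x x + 2 * dot x z * t + dot z z * t ^+ 2.
Proof. by rewrite !(dotDl, dotDr, dotZl, dotZr) (dotC z x); ring. Qed.

(** At the origin the convention [0^-1 = 0] gives the value [0], so homogeneity holds without
    exception. *)
Definition cubic_quot x := cubic x / dot x x.

Lemma cubic_quotZ (a : R) x : cubic_quot (a *: x) = a * cubic_quot x.
Proof.
rewrite /cubic_quot cubicZ dotZl dotZr.
have [->|a0] := eqVneq a 0; first by rewrite expr0n/= !mul0r.
have [->|x0] := eqVneq x 0; first by rewrite cubic0 mulr0 !mul0r mulr0.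
by field; rewrite dot_eq0 x0 a0.
Qed.

Hypothesis cubic_bound : forall x, 27 * cubic x ^+ 2 <= dot x x ^+ 3.

Lemma cubic_quot_sum p q (mu := 2 * (cubic_quot p + cubic_quot q)) : 0 < mu ->
  dot (p + q) (p + q) < 3 * mu ^+ 2 ->
  mu ^+ 3 - dot (p + q) (p + q) * mu + 2 * cubic (p + q) <= 0.
Proof.
have : mu = 2 * (cubic_quot p + cubic_quot q) by [].
move: mu => mu muE mu0 vmu; rewrite leNgt; apply/negP => chi0.
have [v vE] : {v | v = p + q} by exists (p + q).
rewrite -vE in vmu chi0.
(* If the line met the origin, [p] and [q] would be multiples of [v] and [mu] would be [2 h(v)];
   then [vmu] contradicts [cubic_bound]. *)
have indep t : p + t *: (- v) != 0.
  apply/eqP => /eqP; rewrite scalerN subr_eq0 => /eqP pE.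
  have qE : q = (1 - t) *: v by rewrite scalerBl scale1r -pE vE addrC addKr.
  have muv : mu = 2 * cubic_quot v.
    by rewrite muE {1}pE {1}qE !cubic_quotZ; ring.
  have v0 : v != 0.
    by apply: contraTneq mu0 => v0; rewrite muv v0 /cubic_quot cubic0 mul0r mulr0 ltxx.
  have N0 := dot_gt0 v0; have b := cubic_bound v.
  have muN : mu * dot v v = 2 * cubic v by rewrite muv /cubic_quot; field; rewrite gt_eqF.
  have : dot v v * dot v v ^+ 2 < 3 * mu ^+ 2 * dot v v ^+ 2 by rewrite ltr_pM2r// exprn_gt0.
  have -> : 3 * mu ^+ 2 * dot v v ^+ 2 = 3 * (mu * dot v v) ^+ 2 by ring.
  by rewrite muN -exprS; have := sqr_ge0 (cubic v); lra.
pose X := mu ^+ 3 - dot v v * mu + 2 * cubic v; pose Y := 3 * mu ^+ 2 - dot v v.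
have X0 : 0 < X by []. have Y0 : 0 < Y by rewrite subr_gt0.
have mu3 : 0 < mu ^+ 3 by rewrite exprn_gt0.
have mu2 : 0 < mu ^+ 2 by rewrite exprn_gt0.
(* Small enough for both strict inequalities on [mu] to survive the scaling by [k = 1 - e], given
   that [k ^+ 2 >= 1 - 2 e]. *)
pose e := Num.min (1 / 2) (Num.min (Y / (12 * mu ^+ 2)) (X / (4 * mu ^+ 3))).
have e0 : 0 < e by rewrite !lt_min !divr_gt0//; rewrite mulr_gt0.
have e1 : e <= 1 / 2 by rewrite ge_min lexx.
have e2 : e * (12 * mu ^+ 2) <= Y.
  by rewrite -ler_pdivlMr ?mulr_gt0// !ge_min lexx !orbT.
have e3 : e * (4 * mu ^+ 3) <= X.
  by rewrite -ler_pdivlMr ?mulr_gt0// !ge_min lexx !orbT.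
pose k := 1 - e.
have k0 : 0 < k by rewrite /k; lra.
have k1 : k < 1 by rewrite /k; lra.
have k2 : 1 - 2 * e <= k ^+ 2 by rewrite /k; have := sqr_ge0 e; lra.
pose w := - v.
have dN t : dot p p + 2 * dot p w * t + dot w w * t ^+ 2 = dot (p + t *: w) (p + t *: w).
  by rewrite dot_line.
have dC t : k * cubic p + k * (Phi p p w / 2) * t + k * (Phi p w w / 2) * t ^+ 2 +
    k * cubic w * t ^+ 3 = k * cubic (p + t *: w) by rewrite cubic_line; ring.
have pw1 : p + 1 *: w = - q by rewrite scale1r /w vE opprD addrA subrr add0r.
have pw0 : p + 0 *: w = p by rewrite scale0r addr0.
have wE : dot w w = dot v v by rewrite dotNl dotNr opprK.
apply: (@pencil_absurd R (dot p p) (2 * dot p w) (dot w w) (k * cubic p)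
  (k * (Phi p p w / 2)) (k * (Phi p w w / 2)) (k * cubic w) _ _ (k * mu)).
- by move=> t; rewrite dN dot_gt0.
- move=> t; rewrite dN dC; apply: (@le_lt_trans _ _ (k ^+ 2 * dot (p + t *: w) (p + t *: w) ^+ 3)).
    by rewrite exprMn mulrCA ler_pM2l ?exprn_gt0.
  by rewrite gtr_pMl ?exprn_gt0 ?dot_gt0// expr_lt1// ltW.
- by rewrite mulr_gt0.
- rewrite wE exprMn.
  have : 3 * ((1 - 2 * e) * mu ^+ 2) <= 3 * (k ^+ 2 * mu ^+ 2) by rewrite ler_pM2l// ler_pM2r.
  by rewrite /Y in e2 Y0; lra.
- rewrite wE cubicN.
  have -> : (k * mu) ^+ 3 - dot v v * (k * mu) - 2 * (k * - cubic v) =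
    k * (k ^+ 2 * mu ^+ 3 - dot v v * mu + 2 * cubic v) by ring.
  apply: mulr_gt0 => //.
  have : (1 - 2 * e) * mu ^+ 3 <= k ^+ 2 * mu ^+ 3 by rewrite ler_pM2r.
  by rewrite /X in e3 X0; lra.
- rewrite !dN !dC pw0 pw1 cubicN dotNl dotNr opprK muE /cubic_quot.
  by rewrite mulrN mulNr opprK -!mulrA -mulrDr mulrCA.
Qed.

Lemma cubic_abs_le x : `|cubic x| <= enorm x ^+ 3.
Proof.
rewrite -ler_sqr ?nnegrE ?exprn_ge0 ?sqrtr_ge0// real_normK ?num_real//.
rewrite -exprM mulnC exprM enorm_sqr.
by have := cubic_bound x; have := sqr_ge0 (cubic x); lra.
Qed.

(** Otherwise [mu > 2 |v|], where the cubic of [v] is positive because [|P(v)| <= |v|^3], against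
    [cubic_quot_sum]. *)
Lemma cubic_quot_sum_le p q : cubic_quot p + cubic_quot q <= enorm (p + q).
Proof.
rewrite leNgt; apply/negP; set v := p + q => h.
have nv : 0 <= enorm v by exact: sqrtr_ge0.
have N : enorm v ^+ 2 = dot v v by exact: enorm_sqr.
have := @cubic_quot_sum p q; rewrite -/v -N; set mu := 2 * _ => hmu.
have mu2 : 2 * enorm v < mu by rewrite /mu; lra.
have := hmu ltac:(lra) ltac:(nra).
have := cubic_abs_le v; rewrite ler_norml => /andP[c1 c2].
have : 0 < mu * (mu ^+ 2 - enorm v ^+ 2) - 2 * enorm v ^+ 3.
  move: (enorm v) nv mu2 => a a0 am.
  have -> : mu * (mu ^+ 2 - a ^+ 2) - 2 * a ^+ 3 =
     (mu - 2 * a) * (mu ^+ 2 + 2 * mu * a + 3 * a ^+ 2) + 4 * a ^+ 3 by ring.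
  by rewrite ltr_wpDr ?mulr_ge0 ?exprn_ge0// mulr_gt0//; nra.
lra.
Qed.

End CubicForm.

(** * Duality *)

Section LinearFunctional.
Variables (R : realType) (m : nat) (f : 'rV[R]_m -> R).
Hypothesis fD : forall x y, f (x + y) = f x + f y.
Hypothesis fZ : forall a x, f (a *: x) = a * f x.

Lemma functional_coord x : f x = \sum_i x 0 i * f (delta_mx 0 i).
Proof.
have f0 : f 0 = 0 by rewrite -(scale0r 0) fZ mul0r.
by rewrite {1}(row_sum_delta x) (big_morph f fD f0); apply: eq_bigr => i _; rewrite fZ.
Qed.

Lemma functional_continuous : continuous f.
Proof.
have -> : f = (fun x => \sum_i x 0 i * f (delta_mx 0 i)).
  by apply/funext => y; exact: functional_coord.
apply: continuous_big => [|i _ x]; first exact: add_continuous.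
by apply: continuousM; [exact: coord_continuous|exact: cst_continuous].
Qed.

End LinearFunctional.

(** * The dual cone of semidefinite forms *)

Section PsdDual.
Variables (R : realType) (n : nat).
Implicit Types (A B D M : 'M[R]_n) (z : 'rV[R]_n).

Definition qform M z : R := (z *m M *m z^T) 0 0.

Definition psd M := forall z, 0 <= qform M z.

(* The dual cone of the positive semidefinite forms is again that cone; taking
   duality as the definition spares us the spectral theorem. *)
Definition psd_dual B := B^T = B /\ forall D, psd D -> 0 <= \tr (B *m D).

Lemma qformE M z : qform M z = \sum_i \sum_j z 0 i * z 0 j * M i j.
Proof.
rewrite /qform mxE exchange_big; apply: eq_bigr => j _ /=.
by rewrite mxE mulr_suml; apply: eq_bigr => i _; rewrite !mxE; ring.
Qed.

Lemma qformD M M' z : qform (M + M') z = qform M z + qform M' z.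
Proof. by rewrite /qform mulmxDr mulmxDl mxE. Qed.

Lemma qformZ (a : R) M z : qform (a *: M) z = a * qform M z.
Proof. by rewrite /qform -scalemxAr -scalemxAl mxE. Qed.

Lemma qformN M z : qform (- M) z = - qform M z.
Proof. by rewrite -scaleN1r qformZ mulN1r. Qed.

Lemma qform1 z : qform 1%:M z = dot z z.
Proof. by rewrite /qform mulmx1 dot_mx. Qed.

Lemma qform_rank1 (x y z : 'rV[R]_n) : qform (x^T *m y) z = dot z x * dot z y.
Proof.
rewrite /qform mulmxA -mulmxA mxE big_ord1 (dotC z y) !dot_mx.
by congr (_ * _); rewrite !mxE; apply: eq_bigr => i _; rewrite !mxE.
Qed.

Lemma dot_delta z i : dot z (delta_mx 0 i) = z 0 i.
Proof. by rewrite dot_mx trmx_delta -colE mxE. Qed.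

Lemma trace_rank1 (x y : 'rV[R]_n) M : \tr (x^T *m y *m M) = (y *m M *m x^T) 0 0.
Proof. by rewrite -mulmxA mxtrace_mulC /mxtrace big_ord1. Qed.

Lemma qformZv (a : R) M z : qform M (a *: z) = a ^+ 2 * qform M z.
Proof. by rewrite /qform linearZ /= -scalemxAr -!scalemxAl scalerA mxE expr2. Qed.

Lemma psd_dual0 : psd_dual 0.
Proof. by split; [rewrite trmx0|move=> D _; rewrite mul0mx mxtrace0]. Qed.

Lemma psd_dualD B B' : psd_dual B -> psd_dual B' -> psd_dual (B + B').
Proof.
move=> [s p] [s' p']; split; first by rewrite linearD /= s s'.
by move=> D hD; rewrite mulmxDl mxtraceD addr_ge0 ?p ?p'.
Qed.

Lemma psd_dualZ (a : R) B : 0 <= a -> psd_dual B -> psd_dual (a *: B).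
Proof.
move=> a0 [s p]; split; first by rewrite linearZ /= s.
by move=> D hD; rewrite -scalemxAl mxtraceZ mulr_ge0// p.
Qed.

Lemma psd_dual_rank1 z : psd_dual (z^T *m z).
Proof.
split; first by rewrite trmx_mul trmxK.
by move=> D hD; rewrite trace_rank1; exact: hD.
Qed.

Lemma psd_dual1 : psd_dual 1%:M.
Proof.
split; first by rewrite trmx1.
move=> D hD; rewrite mul1mx; apply: sumr_ge0 => i _.
have := hD (delta_mx 0 i); rewrite /qform trmx_delta -rowE.
by rewrite -colE !mxE.
Qed.

(** The test forms are [z^T z] and [|z|^2 1 - z^T z], the latter semidefinite by Cauchy-Schwarz. *)
Lemma psd_dual_bounds B z : psd_dual B ->
  0 <= qform B z <= \tr B * dot z z.
Proof.
move=> [_ p]; apply/andP; split.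
  have := p (z^T *m z); rewrite mxtrace_mulC trace_rank1; apply.
  by move=> y; rewrite qform_rank1 -expr2 sqr_ge0.
have := p (dot z z *: 1%:M - z^T *m z).
rewrite mulmxBr linearB /= -scalemxAr mulmx1 mxtraceZ mxtrace_mulC trace_rank1 subr_ge0 mulrC.
apply=> y; rewrite qformD qformN qformZ qform1 qform_rank1 subr_ge0 -expr2.
by rewrite mulrC; exact: dot_cauchy.
Qed.

(** The test forms are [1 + E_ij] and [1 - E_ij], with values [|y|^2 + y_i y_j] and
    [|y|^2 - y_i y_j]. *)
Lemma psd_dual_entry B i j : psd_dual B -> `|B i j| <= \tr B.
Proof.
move=> [sB p].
have tD : \tr (B *m delta_mx i j) = B i j.
  rewrite -(mul_delta_mx (0 : 'I_1)) mulmxA mxtrace_mulC mulmxA -rowE -colE /mxtrace big_ord1.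
  by rewrite !mxE -{1}sB mxE.
have pos (e : R) : e ^+ 2 = 1 -> 0 <= \tr B + e * B i j.
  move=> e1; have := p (1%:M + e *: delta_mx i j).
  rewrite mulmxDr mulmx1 -scalemxAr mxtraceD mxtraceZ tD; apply=> y.
  rewrite qformD qformZ qform1.
  have -> : qform (delta_mx i j) y = y 0 i * y 0 j.
    by rewrite -(mul_delta_mx (0 : 'I_1)) -trmx_delta qform_rank1 !dot_delta.
  have h : y 0 i ^+ 2 + y 0 j ^+ 2 <= 2 * dot y y.
    have le1 k : y 0 k ^+ 2 <= dot y y.
      rewrite /dot (bigD1 k)//= -expr2 lerDl sumr_ge0// => l _.
      by rewrite -expr2 sqr_ge0.
    by have := le1 i; have := le1 j; lra.
  have := sqr_ge0 (y 0 i + e * y 0 j); nra.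
have := pos 1; have := pos (- 1); rewrite sqrrN expr1n => /(_ erefl) h1 /(_ erefl) h2.
by rewrite ler_norml; apply/andP; split; lra.
Qed.

(** The first-order condition at a minimum over a segment; an explicit [t] replaces the limit
    [t -> 0]. *)
Lemma ge0_of_quadratic (X Y : R) : 0 <= Y ->
  (forall t, 0 <= t <= 1 -> 0 <= 2 * t * X + t ^+ 2 * Y) -> 0 <= X.
Proof.
move=> Y0 h; rewrite leNgt; apply/negP => X0.
have YX : 0 < Y - X by lra.
pose t := - X / (Y - X).
have tYX : t * (Y - X) = - X by rewrite divfK ?gt_eqF.
have t0 : 0 < t by rewrite divr_gt0 ?oppr_gt0.
have t1 : t <= 1 by rewrite ler_pdivrMr// mul1r; lra.
have := h t; rewrite t1 ltW// => /(_ isT).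
have -> : 2 * t * X + t ^+ 2 * Y = t * (2 * X + t * Y) by ring.
by rewrite pmulr_rge0// leNgt => /negP; apply; nra.
Qed.

Definition psd_dual_ball (L : R) := [set x : 'rV[R]_(n * n) |
  psd_dual (vec_mx x) /\ \tr (vec_mx x) <= L].

(** The trace bounds every entry, and each defining condition is a closed condition on a linear
    functional. *)
Lemma psd_dual_ball_compact L : compact (psd_dual_ball L).
Proof.
apply: bounded_closed_compact.
  exists L; split; first exact: num_real.
  move=> M LM x [hx tx] /=; rewrite [leLHS]/Num.norm /= mx_normrE.
  have L0 : 0 <= L.
    apply: le_trans tx; have := hx.2 1%:M; rewrite mulmx1; apply=> z.
    by rewrite qform1 dot_ge0.
  apply/bigmax_leP; split; first by rewrite (le_trans L0)// ltW.
  move=> [i k] _ /=; rewrite ord1 -(vec_mxK x).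
  case/mxvec_indexP: k => i' j; rewrite mxvecE.
  by apply: le_trans (psd_dual_entry _ _ hx) _; rewrite (le_trans tx)// ltW.
have trc D : continuous (fun x : 'rV[R]_(n * n) => \tr (vec_mx x *m D)).
  apply: functional_continuous => [x y|a x].
    by rewrite linearD /= mulmxDl mxtraceD.
  by rewrite linearZ /= -scalemxAl mxtraceZ.
have -> : psd_dual_ball L =
  (\bigcap_(ij in [set: 'I_n * 'I_n])
     [set x : 'rV[R]_(n * n) | vec_mx x ij.1 ij.2 - vec_mx x ij.2 ij.1 = 0]) `&`
  (\bigcap_(D in psd) [set x : 'rV[R]_(n * n) | 0 <= \tr (vec_mx x *m D)]) `&`
  [set x | \tr (vec_mx x *m 1%:M) <= L].
  apply/seteqP; split => x.
    move=> [[s p] t]; split; last by rewrite /= mulmx1.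
    split; last by move=> D hD; exact: p.
    by move=> [i j] _ /=; rewrite -{1}s mxE subrr.
  move=> [[s p]] /=; rewrite mulmx1 => t; split => //; split; last by move=> D hD; exact: p.
  apply/matrixP => i j; rewrite mxE; apply/esym/eqP; rewrite -subr_eq0; apply/eqP.
  exact: (s (i, j)).
apply: closedI; first apply: closedI.
- apply: closed_bigI => ij _.
  have cf : continuous (fun x : 'rV[R]_(n * n) => vec_mx x ij.1 ij.2 - vec_mx x ij.2 ij.1).
    apply: functional_continuous => [x y|a x]; first by rewrite linearD /= !mxE; ring.
    by rewrite linearZ /= !mxE; ring.
  exact: ((continuous_closedP _).1 cf _ (@closed_eq R 0)).
- apply: closed_bigI => D _.
  exact: ((continuous_closedP _).1 (trc D) _ (@closed_ge R 0)).
- exact: ((continuous_closedP _).1 (trc 1%:M) _ (@closed_le R L)).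
Qed.

(* If the minimum over a compact convex set of [tr(A N1)^2 + tr(A N2)^2] were
   positive, the minimizer would single out a combination of [N1], [N2] on which
   all [A] of the family have positive trace. *)
Lemma exists_common_null (N1 N2 : 'M[R]_n) (L : R) : 0 <= L ->
  (forall s t : R, exists2 z, dot z z <= 1 &
     \tr (s *: N1 + t *: N2) + L * qform (s *: N1 + t *: N2) z <= 0) ->
  exists B, [/\ psd_dual B, \tr B <= L, \tr ((1%:M + B) *m N1) = 0 &
                \tr ((1%:M + B) *m N2) = 0].
Proof.
move=> L0 hyp.
pose g N (x : 'rV[R]_(n * n)) := \tr ((1%:M + vec_mx x) *m N).
have gE N x : g N x = \tr N + \tr (vec_mx x *m N) by rewrite /g mulmxDl mul1mx mxtraceD.
have gc N : continuous (g N).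
  have -> : g N = (fun x => \tr N + \tr (vec_mx x *m N)) by apply/funext => x; exact: gE.
  have lc : continuous (fun x : 'rV[R]_(n * n) => \tr (vec_mx x *m N)).
    apply: functional_continuous => [y z|a y]; first by rewrite linearD /= mulmxDl mxtraceD.
    by rewrite linearZ /= -scalemxAl mxtraceZ.
  by move=> x; exact: (cvgD (cvg_cst _) (lc x)).
have [||x xS xmin] := @EVT_min_rV R _ (fun x => g N1 x ^+ 2 + g N2 x ^+ 2)
    (psd_dual_ball L) _ (@psd_dual_ball_compact L).
- by exists 0; split; rewrite linear0; [exact: psd_dual0|rewrite mxtrace0].
- apply: continuous_subspaceT => x.
  exact: (cvgD (cvgM (gc N1 x) (gc N1 x)) (cvgM (gc N2 x) (gc N2 x))).
rewrite inE in xS; case: (xS) => [px tx].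
pose s := g N1 x; pose t := g N2 x.
have [z z1 zN] := hyp s t.
(* The competitor [L z^T z] belongs to the family because [|z| <= 1], and [zN] says that its value
   against [s N1 + t N2] is nonpositive. *)
have [B BE] : {B | B = L *: (z^T *m z)} by exists (L *: (z^T *m z)).
have pB : psd_dual B by rewrite BE; apply: psd_dualZ => //; exact: psd_dual_rank1.
have tB : \tr B <= L.
  rewrite BE mxtraceZ -[z^T *m z]mulmx1 trace_rank1 -/(qform _ _) qform1.
  by rewrite -{2}[L]mulr1 ler_wpM2l.
pose y := mxvec B.
have convex a : 0 <= a <= 1 -> psd_dual_ball L (x + a *: (y - x)).
  move=> /andP[a0 a1]; rewrite /psd_dual_ball /= linearD linearZ linearB /= mxvecK.
  have -> : vec_mx x + a *: (B - vec_mx x) = (1 - a) *: vec_mx x + a *: B.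
    by rewrite scalerBr scalerBl scale1r -addrA [- _ + _]addrC.
  split; first by apply: psd_dualD; apply: psd_dualZ => //; rewrite subr_ge0.
  rewrite mxtraceD !mxtraceZ.
  rewrite (_ : L = (1 - a) * L + a * L); last by ring.
  by apply: lerD; rewrite ler_wpM2l ?subr_ge0.
have glin N a : g N (x + a *: (y - x)) = g N x + a * (g N y - g N x).
  rewrite !gE linearD linearZ linearB /= mulmxDl -scalemxAl mulmxBl.
  by rewrite mxtraceD mxtraceZ linearB /=; ring.
have X0 : 0 <= s * (g N1 y - s) + t * (g N2 y - t).
  apply: (@ge0_of_quadratic _ ((g N1 y - s) ^+ 2 + (g N2 y - t) ^+ 2)).
    by rewrite addr_ge0 ?sqr_ge0.
  move=> a a01; have := xmin (x + a *: (y - x)).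
  rewrite inE => /(_ (convex a a01)); rewrite !glin -/s -/t; lra.
have Ey : s * g N1 y + t * g N2 y <= 0.
  move: zN; rewrite !gE mxvecK BE -!scalemxAl !mxtraceZ !trace_rank1 -!/(qform _ _).
  by rewrite mxtraceD !mxtraceZ qformD !qformZ; lra.
(* [X0] is the first-order condition [s^2 + t^2 <= s g1(y) + t g2(y)], and [Ey] bounds its right
   side by [0]. *)
have s0 : s ^+ 2 + t ^+ 2 <= 0 by lra.
have s20 : s ^+ 2 = 0 by apply/eqP; rewrite eq_le sqr_ge0 andbT; have := sqr_ge0 t; lra.
have t20 : t ^+ 2 = 0 by apply/eqP; rewrite eq_le sqr_ge0 andbT; have := sqr_ge0 s; lra.
exists (vec_mx x); split=> //.
  by apply/eqP; rewrite -[_ == 0]sqrf_eq0; apply/eqP.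
by apply/eqP; rewrite -[_ == 0]sqrf_eq0; apply/eqP.
Qed.

End PsdDual.

(** * The normalized Hessian *)

Section NormalizedHessian.
Variables (R : realType) (n : nat) (Phi : 'rV[R]_n -> 'rV[R]_n -> 'rV[R]_n -> R).
Variable delta : R.
Implicit Types (p q v x y z : 'rV[R]_n).
Hypothesis PhiD : forall x x' y z, Phi (x + x') y z = Phi x y z + Phi x' y z.
Hypothesis PhiZ : forall (a : R) x y z, Phi (a *: x) y z = a * Phi x y z.
Hypothesis PhiC12 : forall x y z, Phi x y z = Phi y x z.
Hypothesis PhiC23 : forall x y z, Phi x y z = Phi x z y.

Local Notation cubic := (cubic Phi).
Local Notation cubic_quot := (cubic_quot Phi).
Let PhiD2 := PhiD2 PhiD PhiC12.
Let PhiD3 := PhiD3 PhiD PhiC12 PhiC23.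
Let PhiZ2 := PhiZ2 PhiZ PhiC12.
Let PhiZ3 := PhiZ3 PhiZ PhiC12 PhiC23.
Let cubic_quotZ := cubic_quotZ PhiZ PhiC12 PhiC23.

Definition Phi_mx p : 'M[R]_n := \matrix_(i, j) Phi p (delta_mx 0 i) (delta_mx 0 j).

Definition Phi_row p : 'rV[R]_n := \row_j Phi p p (delta_mx 0 j).

(* [|p|^delta] times the Hessian at [p] of [cubic x / |x|^delta]. *)
Definition nhess p : 'M[R]_n := Phi_mx p - (delta / dot p p) *: (p^T *m Phi_row p)
  - (delta * cubic_quot p) *: 1%:M
  + (delta * (delta + 2) * cubic_quot p / dot p p) *: (p^T *m p).

Lemma qform_Phi_mx p z : qform (Phi_mx p) z = Phi p z z.
Proof.
rewrite qformE (@functional_coord R n (fun y => Phi p y z)) => [|x y|a x]; last 2 first.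
- exact: PhiD2.
- exact: PhiZ2.
apply: eq_bigr => i _.
rewrite (@functional_coord R n (fun y => Phi p (delta_mx 0 i) y)) => [|x y|a x]; last 2 first.
- exact: PhiD3.
- exact: PhiZ3.
by rewrite mulr_sumr; apply: eq_bigr => j _; rewrite mxE mulrA.
Qed.

Lemma dot_Phi_row p z : dot z (Phi_row p) = Phi p p z.
Proof.
rewrite (@functional_coord R n (fun y => Phi p p y)) => [|x y|a x]; last 2 first.
- exact: PhiD3.
- exact: PhiZ3.
by apply: eq_bigr => j _; rewrite mxE.
Qed.

Lemma qform_nhess p z : qform (nhess p) z =
  Phi p z z - delta / dot p p * (dot p z * Phi p p z) - delta * cubic_quot p * dot z z
  + delta * (delta + 2) * cubic_quot p / dot p p * dot p z ^+ 2.
Proof.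
rewrite /nhess !(qformD, qformN, qformZ) qform1 !qform_rank1 qform_Phi_mx dot_Phi_row.
by rewrite !(dotC z p) expr2.
Qed.

Lemma nhess0 : nhess 0 = 0.
Proof.
have -> : nhess 0 = Phi_mx 0.
  by rewrite /nhess /cubic_quot cubic0// !(mul0r, mulr0) trmx0 !mul0mx !(scale0r, scaler0) !subr0 addr0.
by apply/matrixP => i j; rewrite !mxE -(scale0r 0) PhiZ mul0r.
Qed.

Lemma nhessZ (a : R) p : nhess (a *: p) = a *: nhess p.
Proof.
have [->|a0] := eqVneq a 0; first by rewrite !scale0r nhess0.
have [->|p0] := eqVneq p 0; first by rewrite scaler0 nhess0 scaler0.
have dp : dot p p != 0 by rewrite dot_eq0.
rewrite /nhess cubic_quotZ dotZl dotZr; apply/matrixP => i j.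
rewrite !mxE !big_ord1 !mxE !(PhiZ, PhiZ2).
by field; rewrite dp a0.
Qed.

Lemma nhessN p : nhess (- p) = - nhess p.
Proof. by rewrite -scaleN1r nhessZ scaleN1r. Qed.

(** The vector representing the Laplacian of the cubic form, which is linear in the point. *)
Definition Phi_trace : 'rV[R]_n := \row_k \sum_i Phi (delta_mx 0 k) (delta_mx 0 i) (delta_mx 0 i).

Lemma trace_nhess p : \tr (nhess p) =
  dot p Phi_trace - delta * (n%:R + 4 - delta) * cubic_quot p.
Proof.
rewrite /nhess !(mxtraceD, mxtraceZ, mxtrace1) !raddfN /= !mxtraceZ mxtrace1.
rewrite -[p^T *m p]mulmx1 -[p^T *m Phi_row p]mulmx1 !trace_rank1 !mulmx1 -!dot_mx.
rewrite (dotC (Phi_row p)) dot_Phi_row.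
have -> : \tr (Phi_mx p) = dot p Phi_trace.
  pose f x := \sum_i Phi x (delta_mx 0 i) (delta_mx 0 i).
  transitivity (f p); first by apply: eq_bigr => i _; rewrite mxE.
  rewrite (@functional_coord R n f) => [|x y|a x]; last 2 first.
  - by rewrite /f -big_split; apply: eq_bigr => i _; rewrite PhiD.
  - by rewrite /f mulr_sumr; apply: eq_bigr => i _; rewrite PhiZ.
  by apply: eq_bigr => k _; rewrite mxE.
have [->|p0] := eqVneq p 0.
  by rewrite /cubic_quot !dot0l invr0 !mulr0 !mul0r !subr0 addr0.
rewrite /cubic_quot /cubic; field.
by rewrite dot_eq0 p0.
Qed.

Hypothesis cubic_bound : forall x, 27 * cubic x ^+ 2 <= dot x x ^+ 3.
Hypothesis delta_ge0 : 0 <= delta.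
Hypothesis delta_lt2 : delta < 2.
Hypothesis Phi_large : forall v a b (T0 eps : R), 0 < eps -> 0 <= T0 ->
  dot v v <= 3 * T0 ^+ 2 -> T0 ^+ 3 - dot v v * T0 + 2 * cubic v <= 0 ->
  exists z, [/\ z != 0, dot z a = 0, dot z b = 0 & (T0 - eps) * dot z z <= Phi v z z].

Let r : R := Num.sqrt (1 / 3).
(** Half of [(1 - delta / 2) r]; the other half pays for the [eps] of [Phi_large]. *)
Let c := (1 - delta / 2) * r / 2.

Let r_gt0 : 0 < r. Proof. by rewrite sqrtr_gt0; lra. Qed.

Let r2 : r ^+ 2 = 1 / 3. Proof. by rewrite sqr_sqrtr//; lra. Qed.

Let c_gt0 : 0 < c.
Proof. by rewrite divr_gt0// mulr_gt0//; move: (delta_lt2) => ?; lra. Qed.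

(** For [z] orthogonal to [p] and [q] the form is [D^2 P(v) - (delta / 2) mu]. The first term is
    nearly [T0] and [mu <= T0], which leaves a margin close to [(1 - delta / 2) T0], with
    [T0 >= r |v|]. *)
Lemma nhess_sum_lower p q : p + q != 0 -> exists2 z, dot z z = 1 &
  c * enorm (p + q) <= qform (nhess p + nhess q) z.
Proof.
move=> v0; set v := p + q in v0 *.
have N : enorm v ^+ 2 = dot v v by exact: enorm_sqr.
have m0 : 0 < enorm v by rewrite enorm_dot sqrtr_gt0 dot_gt0.
pose mu := 2 * (cubic_quot p + cubic_quot q).
(* The second candidate [|v| / sqrt 3] is the critical point of the cubic of [v], whose value there
   is nonpositive by [cubic_bound]; the first is covered by [cubic_quot_sum]. *)
pose T0 := Num.max mu (r * enorm v).
have rm : 0 < r * enorm v by rewrite mulr_gt0.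
have T0r : r * enorm v <= T0 by rewrite le_max lexx orbT.
have T0mu : mu <= T0 by rewrite le_max lexx.
have chir : (r * enorm v) ^+ 3 - dot v v * (r * enorm v) + 2 * cubic v <= 0.
  have : cubic v <= r * enorm v ^+ 3 / 3.
    rewrite (le_trans (ler_norm _))// -ler_sqr ?nnegrE//; last first.
      by rewrite divr_ge0// mulr_ge0// ?exprn_ge0// ltW.
    rewrite real_normK ?num_real//.
    have -> : (r * enorm v ^+ 3 / 3) ^+ 2 = r ^+ 2 * (enorm v ^+ 2) ^+ 3 / 9 by field.
    by rewrite r2 N; have := cubic_bound v; lra.
  have -> : (r * enorm v) ^+ 3 = r ^+ 2 * (r * enorm v ^+ 3) by ring.
  have -> : dot v v * (r * enorm v) = r * enorm v ^+ 3 by rewrite -N; ring.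
  by rewrite r2; lra.
have T0v : dot v v <= 3 * T0 ^+ 2.
  rewrite -N; have : (r * enorm v) ^+ 2 <= T0 ^+ 2.
    by rewrite ler_sqr// nnegrE ltW// (lt_le_trans rm).
  by rewrite exprMn r2; lra.
have chi0 : T0 ^+ 3 - dot v v * T0 + 2 * cubic v <= 0.
  rewrite /T0; case: (leP mu (r * enorm v)) => // lt.
  have h1 : 0 < mu by exact: lt_trans rm lt.
  have h2 : dot v v < 3 * mu ^+ 2.
    rewrite -N; have : (r * enorm v) ^+ 2 < mu ^+ 2 by rewrite ltr_sqr// nnegrE ltW.
    by rewrite exprMn r2; lra.
  exact: (cubic_quot_sum PhiD PhiZ PhiC12 PhiC23 cubic_bound h1 h2).
have e0 : 0 < c * enorm v by rewrite mulr_gt0.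
have [z [z0 zp zq zP]] := Phi_large p q e0 (le_trans (ltW rm) T0r) T0v chi0.
have dz := dot_gt0 z0.
have low : c * enorm v * dot z z <= qform (nhess p + nhess q) z.
  rewrite qformD !qform_nhess !(dotC _ z) zp zq.
  have PE : Phi v z z = Phi p z z + Phi q z z by rewrite PhiD.
  have : (1 - delta / 2) * (r * enorm v) <= (1 - delta / 2) * T0.
    by rewrite ler_wpM2l//; move: (delta_lt2) => ?; lra.
  have : delta / 2 * mu <= delta / 2 * T0.
    by rewrite ler_wpM2l//; move: (delta_ge0) => ?; lra.
  rewrite !mul0r !expr0n /= !mulr0 !addr0 !subr0 => l1 l2.
  have : (2 * (c * enorm v) + delta / 2 * mu) * dot z z <= T0 * dot z z.
    rewrite ler_pM2r//; apply: le_trans (_ : (1 - delta / 2) * T0 + delta / 2 * T0 <= _).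
      apply: lerD => //; apply: le_trans l2.
      by rewrite /c; lra.
    by lra.
  move: zP; rewrite PE /mu; lra.
have s0 : 0 < enorm z by rewrite enorm_dot sqrtr_gt0.
exists ((enorm z)^-1 *: z).
  by rewrite dotZl dotZr -enorm_sqr; field; rewrite gt_eqF.
by rewrite qformZv exprVn enorm_sqr [leRHS]mulrC ler_pdivlMr.
Qed.

(** The trace is a linear function of [p + q] minus a multiple of [h p + h q]. The latter is at most
    [|p + q|] in absolute value, by [cubic_quot_sum_le] for [p, q] and for [- p, - q]. *)
Lemma trace_nhess_sum : exists2 K, 0 <= K & forall p q,
  \tr (nhess p + nhess q) <= K * enorm (p + q).
Proof.
exists (enorm Phi_trace + `|delta * (n%:R + 4 - delta)|).
  by rewrite addr_ge0 ?sqrtr_ge0.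
move=> p q; rewrite mxtraceD !trace_nhess; set k := delta * _; set v := p + q.
have m0 : 0 <= enorm v by exact: sqrtr_ge0.
have dl : dot v Phi_trace <= enorm Phi_trace * enorm v.
  rewrite (le_trans (ler_norm _))// -ler_sqr ?nnegrE ?mulr_ge0 ?sqrtr_ge0//.
  by rewrite real_normK ?num_real// exprMn !enorm_sqr mulrC dot_cauchy.
have h1 := cubic_quot_sum_le PhiD PhiZ PhiC12 PhiC23 cubic_bound p q.
have h2 := cubic_quot_sum_le PhiD PhiZ PhiC12 PhiC23 cubic_bound (- p) (- q).
have hN x : cubic_quot (- x) = - cubic_quot x by rewrite -scaleN1r cubic_quotZ mulN1r.
have vN : enorm (- p - q) = enorm v by rewrite -opprD !enorm_dot dotNl dotNr opprK.
rewrite !hN vN -/v in h1 h2.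
have : - (k * (cubic_quot p + cubic_quot q)) <= `|k| * enorm v.
  rewrite (le_trans (ler_norm _))// normrN normrM ler_wpM2l// ler_norml.
  by apply/andP; split => //; lra.
by move: dl; rewrite {1}/v dotDl mulrDl; lra.
Qed.

(** By homogeneity [s nhess a + t nhess b] is again a sum [nhess p + nhess q]. Its trace is at most
    [K |p + q|] and some unit vector gives it a value at most [- c |p + q|], so [L = K / c] balances
    the two. *)
Lemma exists_elliptic_null : exists2 L, 0 <= L & forall a b, exists B,
  [/\ psd_dual B, \tr B <= L, \tr ((1%:M + B) *m nhess a) = 0 &
      \tr ((1%:M + B) *m nhess b) = 0].
Proof.
have [K K0 hK] := trace_nhess_sum.
exists (K / c); first by rewrite divr_ge0// ltW.
move=> a b; apply: exists_common_null; first by rewrite divr_ge0// ltW.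
move=> s t; rewrite -!nhessZ; set p := s *: a; set q := t *: b.
have [v0|v0] := eqVneq (p + q) 0.
  exists 0; first by rewrite dot0l.
  have -> : q = - p by apply/eqP; rewrite -addr_eq0 addrC v0.
  by rewrite nhessN subrr mxtrace0 /qform mulmx0 mul0mx mxE mulr0 addr0.
have [|z z1 zl] := @nhess_sum_lower (- p) (- q); first by rewrite -opprD oppr_eq0.
exists z; first by rewrite z1.
have vN : enorm (- p - q) = enorm (p + q) by rewrite -opprD !enorm_dot dotNl dotNr opprK.
rewrite !nhessN vN -opprD qformN in zl.
apply: (@le_trans _ _ (K * enorm (p + q) + K / c * - (c * enorm (p + q)))).
  apply: lerD; first exact: hK.
  by apply: ler_wpM2l; [rewrite divr_ge0 ?(ltW c_gt0)|rewrite lerNr].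
by rewrite mulrN mulrA divfK ?gt_eqF// subrr.
Qed.

End NormalizedHessian.

(** * Second derivatives along lines *)

Section Lines.
Variables (R : realType) (n : nat).
Implicit Types (f : 'rV[R]_n -> R) (x y z v w : 'rV[R]_n).

Lemma is_derive_line f y v (t d : R) :
  is_derive (y + t *: v) v f d -> is_derive t 1 (fun s => f (y + s *: v)) d.
Proof.
have E : (fun h : R => h^-1 *: (((fun s => f (y + s *: v)) \o shift t) (h *: 1) - f (y + t *: v))) =
         (fun h => h^-1 *: ((f \o shift (y + t *: v)) (h *: v) - f (y + t *: v))).
  apply/funext => h /=; congr (_ *: (f _ - _)).
  by rewrite [h *: 1]mulr1 scalerDl addrCA.
move=> [df vf]; split; first by rewrite /derivable E.
by rewrite /derive E.
Qed.

Lemma mvt_line f y v (s : R) :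
  (forall t : R, `|t| <= `|s| -> derivable f (y + t *: v) v) ->
  exists2 t : R, `|t| <= `|s| & f (y + s *: v) - f y = s * 'D_v f (y + t *: v).
Proof.
move=> df; pose g t := f (y + t *: v).
have dg (t : R) : `|t| <= `|s| -> is_derive t 1 g ('D_v f (y + t *: v)).
  by move=> /df/derivableP; exact: is_derive_line.
have cg (a b : R) : (forall t : R, t \in `[a, b] -> `|t| <= `|s|) -> {within `[a, b], continuous g}.
  by move=> ab; apply: derivable_within_continuous => t /ab/dg[].
have g0 : g 0 = f y by rewrite /g scale0r addr0.
have [s0|s0] := leP 0 s.
  have I (t : R) : t \in `[0, s] -> `|t| <= `|s|.
    by rewrite in_itv /= => /andP[t0 ts]; rewrite !ger0_norm.
  have [t|t ts e] := @MVT_segment R g (fun t => 'D_v f (y + t *: v)) _ _ s0 _ (cg _ _ I).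
    by move=> /subset_itv_oo_cc/I/dg.
  by exists t; [exact: I|rewrite -g0 -/(g s) e subr0 mulrC].
have I (t : R) : t \in `[s, 0] -> `|t| <= `|s|.
  rewrite in_itv /= => /andP[t0 ts]; rewrite !ler0_norm ?lerN2// ltW//.
have [t|t ts e] := @MVT_segment R g (fun t => 'D_v f (y + t *: v)) _ _ (ltW s0) _ (cg _ _ I).
  by move=> /subset_itv_oo_cc/I/dg.
exists t; first exact: I.
by rewrite -g0 -/(g s) -opprB e sub0r mulrN opprK mulrC.
Qed.

(** The mean value theorem on a segment shrinking to [x], followed by continuity of the partial
    derivative at [x]. *)
Lemma partial_increment f x w k (c : R) :
  (\forall y \near x, derivable f y (evec R k)) -> {for x, continuous (pd k f)} ->
  h^-1 * (f (x + h *: w + (h * c) *: evec R k) - f (x + h *: w)) @[h --> 0^'] -->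
  c * pd k f x.
Proof.
move=> df cf; apply/cvgrPdist_le => e e0.
have c1 : 0 < 1 + `|c| by rewrite ltr_pwDl.
have [d /= d0 dP] := (nbhs_normP _ _).1
  (filterI df ((cvgrPdist_le _ _).1 cf _ (divr_gt0 e0 c1))).
pose K := `|w| + `|c| * `|evec R k| + 1.
have K0 : 0 < K by rewrite ltr_wpDl// addr_ge0// mulr_ge0.
near=> h.
have h0 : h != 0 by near: h; exact: nbhs_dnbhs_neq.
have hd : `|h| * K < d.
  rewrite -ltr_pdivlMr//; near: h; apply: dnbhs0_lt.
  by rewrite divr_gt0.
have inball (t : R) : `|t| <= `|h * c| -> `|x - (x + h *: w + t *: evec R k)| < d.
  move=> tc; rewrite -addrA opprD addNKr normrN.
  apply: le_lt_trans hd; apply: le_trans (ler_normD _ _) _.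
  rewrite !normrZ /K !mulrDr mulr1.
  have : `|t| * `|evec R k| <= `|h| * (`|c| * `|evec R k|).
    by rewrite mulrA -normrM ler_wpM2r.
  have := normr_ge0 h; lra.
have [t tc ->] := mvt_line (fun t tc => (dP _ (inball t tc)).1).
have [_] := dP _ (inball t tc).
rewrite -/(pd k f _) => hb.
rewrite mulrA mulKf// -mulrBr normrM.
apply: (@le_trans _ _ (`|c| * (e / (1 + `|c|)))); first by rewrite ler_wpM2l.
by rewrite mulrCA ger_pMr// ler_pdivrMr// mul1r lerDr.
Unshelve. all: by end_near. Qed.

Lemma is_derive_partials f x z :
  (\forall y \near x, forall i, derivable f y (evec R i)) ->
  (forall i, {for x, continuous (pd i f)}) ->
  is_derive x z f (\sum_i z 0 i * pd i f x).
Proof.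
move=> df cf.
suff cv : (fun h => h^-1 *: ((f \o shift x) (h *: z) - f x)) @ 0^' -->
    (\sum_i z 0 i * pd i f x : R).
  by split; [exact: (cvgP _ cv)|exact: cvg_lim].
(* [zk k] keeps the first [k] coordinates of [z], so the increment telescopes into steps parallel to
   the axes. *)
pose zk (k : nat) : 'rV[R]_n := \row_i (if (i < k)%N then z 0 i else 0).
have -> : (fun h : R => h^-1 *: ((f \o shift x) (h *: z) - f x)) =
  (fun h => \sum_(i < n) h^-1 * (f (x + h *: zk i + (h * z 0 i) *: evec R i) -
     f (x + h *: zk i))).
  apply/funext => h; rewrite -mulr_sumr; congr (_ * _).
  have zS (i : 'I_n) : x + h *: zk i + (h * z 0 i) *: evec R i = x + h *: zk i.+1.
    rewrite -addrA; congr (_ + _); apply/rowP => j; rewrite !mxE eqxx /= ltnS.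
    rewrite [(j <= i)%N]leq_eqVlt -(inj_eq val_inj) /=.
    case: (eqVneq (val j) (val i)) => [/val_inj ->|_] /=.
      by rewrite ltnn mulr0 add0r mulr1.
    by rewrite mulr0 addr0.
  under eq_bigr do rewrite zS.
  rewrite -(big_mkord xpredT (fun i => f (x + h *: zk i.+1) - f (x + h *: zk i))).
  rewrite telescope_sumr//; congr (f _ - f _).
    have -> : zk n = z by apply/rowP => j; rewrite mxE ltn_ord.
    by rewrite [RHS]addrC.
  have -> : zk 0%N = 0 by apply/rowP => j; rewrite !mxE ltn0.
  by rewrite scaler0 addr0.
have inc (i : 'I_n) := @partial_increment f x (zk i) i (z 0 i)
  (filterS (fun y (h : forall i, derivable f y (evec R i)) => h i) df) (cf i).
by apply: (cvg_big (P := xpredT) _ (Fa := fun i => z 0 i * pd i f x)) => [|i _];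
  [exact: add_continuous|exact: inc].
Qed.

(** [C2_on] only provides derivatives along the axes; test functions are compared along arbitrary
    lines. *)
Lemma C2_line (U : set 'rV[R]_n) f x z : open U -> C2_on U f -> U x ->
  exists2 g : R -> R,
    (\forall t \near (0 : R), is_derive (t : R) 1 (fun t : R => f (x + t *: z)) (g t)) &
    is_derive (0 : R) 1 g (qform (hessian f x) z).
Proof.
move=> Uo Cf Ux; exists (fun t : R => \sum_i z 0 i * pd i f (x + t *: z)).
  have cl : {for 0, continuous (fun t : R => x + t *: z)}.
    apply: cvgD; first exact: cvg_cst.
    exact: scalel_continuous.
  have : \forall t \near (0 : R), U (x + t *: z).
    by apply: cl; rewrite scale0r addr0; exact: open_nbhs_nbhs.
  apply: filterS => t Ut; apply: is_derive_line; apply: is_derive_partials.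
    apply: filterS (open_nbhs_nbhs (conj Uo Ut)) => y Uy i.
    by have [_ /(_ i)[/(_ _ Uy)]] := Cf _ Uy.
  by move=> i; have [_ /(_ i)[_ []]] := Cf _ Ut.
have d i : is_derive (0 : R) 1 (fun t : R => pd i f (x + t *: z))
    (\sum_j z 0 j * pd j (pd i f) x).
  apply: is_derive_line; rewrite scale0r addr0; apply: is_derive_partials.
    apply: filterS (open_nbhs_nbhs (conj Uo Ux)) => y Uy j.
    by have [_ /(_ i)[_ [_ /(_ j)[/(_ _ Uy)]]]] := Cf _ Uy.
  by move=> j; have [_ /(_ i)[_ [_ /(_ j)[_]]]] := Cf _ Ux.
have -> : (fun t : R => \sum_i z 0 i * pd i f (x + t *: z)) =
   \sum_i (z 0 i \*: (fun t : R => pd i f (x + t *: z))).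
  by apply/funext => t; rewrite fct_sumE.
apply: is_derive_eq.
rewrite qformE; apply: eq_bigr => i _.
by rewrite /GRing.scale /= mulr_sumr; apply: eq_bigr => j _; rewrite mxE mulrA.
Qed.

End Lines.

(** If [k2] were positive, [k1] would be positive just to the right of its zero [0], and [k] would
    increase there. *)
Lemma second_derivative_max (R : realType) (k k1 : R -> R) (k2 : R) :
  (\forall t \near (0 : R), is_derive (t : R) 1 k (k1 t)) -> is_derive (0 : R) 1 k1 k2 ->
  (\forall t \near (0 : R), k t <= k 0) -> k2 <= 0.
Proof.
move=> dk [dk1 k1v] kmax; rewrite leNgt; apply/negP => k20.
have [d /= d0 dP] := (nbhs_normP _ _).1 (filterI dk kmax).
have inI (t : R) : `|t| < d -> is_derive t 1 k (k1 t) /\ k t <= k 0.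
  by move=> td; apply: dP; rewrite /ball_ /= sub0r normrN.
have k10 : k1 0 = 0.
  have h : is_derive (0 : R) 1 k 0.
    apply: (@derive1_at_max _ _ (- d) d) => [|t|/=|t]; rewrite ?in_itv /=.
    - lra.
    - by rewrite -ltr_norml => /inI[[]].
    - by lra.
    - by rewrite -ltr_norml => /inI[].
  have [[_ <-] _] := inI 0 ltac:(by rewrite normr0).
  by case: h.
have : (fun h : R => h^-1 *: ((k1 \o shift 0) (h *: 1) - k1 0)) @ 0^' --> k2.
  by rewrite -k1v; exact: dk1.
move=> /cvgrPdist_lt/(_ _ k20); rewrite near_withinE.
move=> /((nbhs_normP _ _).1)[d' /= d'0 d'P].
pose s := Num.min d d' / 2.
have dd : 0 < Num.min d d' by rewrite lt_min d0.
have s0 : 0 < s by rewrite divr_gt0.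
have sd : s < d by rewrite /s (lt_le_trans (_ : _ < Num.min d d')) ?ge_min ?lexx//; lra.
have sd' : s < d' by rewrite /s (lt_le_trans (_ : _ < Num.min d d')) ?ge_min ?lexx ?orbT//; lra.
have pos (t : R) : 0 < t -> t < d' -> 0 < k1 t.
  move=> t0 td; have := d'P t; rewrite /ball_ /= sub0r normrN gtr0_norm// => /(_ td).
  rewrite gt_eqF// => /(_ isT); rewrite [t *: 1]mulr1 addr0 k10 subr0 /GRing.scale /=.
  rewrite ltr_norml => /andP[_]; rewrite ltrBlDr ltrDl.
  by rewrite pmulr_rgt0// invr_gt0.
have [||t ts e] := @MVT R k k1 0 s s0.
- move=> t; rewrite in_itv /= => /andP[t0 ts]; apply: (inI _ _).1.
  by rewrite gtr0_norm// (lt_trans ts).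
- apply: derivable_within_continuous => t; rewrite in_itv /= => /andP[t0 ts].
  have td : `|t| < d by rewrite ger0_norm// (le_lt_trans ts).
  by case: (inI t td).1.
have : 0 < k s - k 0.
  move: ts; rewrite in_itv /= => /andP[t0 ts].
  by rewrite e subr0 mulr_gt0// pos// (lt_trans ts).
by rewrite subr_gt0 ltNge (inI s _).2// gtr0_norm.
Qed.

(** * A cubic times a power of a quadratic in one variable *)

Section OneVariable.
Variable R : realType.

Lemma is_derive_cubic (c0 c1 c2 c3 t : R) :
  is_derive t 1 (fun s => c0 + c1 * s + c2 * s ^+ 2 + c3 * s ^+ 3)
    (c1 + 2 * c2 * t + 3 * c3 * t ^+ 2).
Proof.
pose p : {poly R} := c0%:P + c1 *: 'X + c2 *: 'X^2 + c3 *: 'X^3.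
have -> : (fun s => c0 + c1 * s + c2 * s ^+ 2 + c3 * s ^+ 3) = horner p.
  by apply/funext => s; rewrite !hornerE.
apply: (is_derive_eq (is_derive_poly p t)).
by rewrite /p !derivD !derivZ derivC derivX !derivXn !hornerE /=; ring.
Qed.

Variables (c0 c1 c2 c3 n0 n1 n2 s : R).
Let p t := c0 + c1 * t + c2 * t ^+ 2 + c3 * t ^+ 3.
Let N t := n0 + n1 * t + n2 * t ^+ 2.
Hypothesis n0_gt0 : 0 < n0.

Let dN (t : R) : is_derive t 1 N (n1 + 2 * n2 * t).
Proof.
have -> : N = (fun t => n0 + n1 * t + n2 * t ^+ 2 + 0 * t ^+ 3).
  by apply/funext => x; rewrite mul0r addr0.
by apply: (is_derive_eq (is_derive_cubic _ _ _ _ _)); ring.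
Qed.

Let dpow (a t : R) : 0 < N t ->
  is_derive t 1 (fun t => N t `^ a) (a * N t `^ (a - 1) * (n1 + 2 * n2 * t)).
Proof.
by move=> Nt; have := is_derive1_comp (is_derive1_powR a Nt) (dN t).
Qed.

Lemma second_derivative_cubic_pow :
  exists2 g : R -> R,
    (\forall t \near (0 : R), is_derive (t : R) 1 (fun t => p t * N t `^ s) (g t)) &
    is_derive (0 : R) 1 g (n0 `^ s * (2 * c2 + 2 * s * c1 * n1 / n0 +
      c0 * (s * (s - 1) * n1 ^+ 2 / n0 ^+ 2 + 2 * s * n2 / n0))).
Proof.
pose p1 t := c1 + 2 * c2 * t + 3 * c3 * t ^+ 2; pose N1 t := n1 + 2 * n2 * t.
have dp (t : R) : is_derive t 1 p (p1 t) by exact: is_derive_cubic.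
have dp1 : is_derive (0 : R) 1 p1 (2 * c2).
  have -> : p1 = (fun t => c1 + 2 * c2 * t + 3 * c3 * t ^+ 2 + 0 * t ^+ 3).
    by apply/funext => x; rewrite mul0r addr0.
  by apply: (is_derive_eq (is_derive_cubic _ _ _ _ _)); ring.
have dN1 : is_derive (0 : R) 1 N1 (2 * n2).
  have -> : N1 = (fun t => n1 + 2 * n2 * t + 0 * t ^+ 2 + 0 * t ^+ 3).
    by apply/funext => x; rewrite !mul0r !addr0.
  by apply: (is_derive_eq (is_derive_cubic _ _ _ _ _)); ring.
have N0 : N 0 = n0 by rewrite /N; ring.
exists (fun t => p1 t * N t `^ s + p t * (s * N t `^ (s - 1) * N1 t)).
  have cN : {for 0, continuous N}.
    by apply/differentiable_continuous; rewrite -derivable1_diffP; case: (dN 0).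
  have : \forall t \near (0 : R), 0 < N t.
    by apply: (cvgr_gt (N 0) cN); rewrite N0.
  apply: filterS => t Nt.
  have := @is_deriveM _ _ p (fun t => N t `^ s) t 1 _ _ (dp t) (dpow s Nt).
  by move/is_derive_eq; apply; rewrite /GRing.scale /= addrC [X in X + _]mulrC.
have N00 : 0 < N 0 by rewrite N0.
have d1 := @is_deriveM _ _ p1 (fun t => N t `^ s) 0 1 _ _ dp1 (dpow s N00).
have d2 := @is_deriveM _ _ (fun t => N t `^ (s - 1)) N1 0 1 _ _ (dpow (s - 1) N00) dN1.
have d3 := @is_deriveM _ _ p (fun t => N t `^ (s - 1) * N1 t) 0 1 _ _ (dp 0) d2.
have d4 := is_deriveD d1 (is_deriveZ s d3).
have -> : (fun t => p1 t * N t `^ s + p t * (s * N t `^ (s - 1) * N1 t)) =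
  p1 * (fun t => N t `^ s) + s \*: (p * (fun t => N t `^ (s - 1) * N1 t)).
  apply/funext => t.
  by rewrite -[RHS]/(p1 t * N t `^ s + s * (p t * (N t `^ (s - 1) * N1 t))); ring.
move/is_derive_eq: d4; apply; rewrite /GRing.scale /= N0.
have n0N : n0 != 0 by rewrite gt_eqF.
have -> : n0 `^ (s - 1 - 1) = n0 `^ s / n0 ^+ 2.
  by rewrite !powRB ?n0N ?implybT// !powRr1 ?ltW//; field.
have -> : n0 `^ (s - 1) = n0 `^ s / n0 by rewrite powRB ?n0N ?implybT// powRr1 ?ltW.
by rewrite /p /p1 /N1; field.
Qed.

End OneVariable.

(** * Viscosity solutions *)

Section Isaacs.
Variables (R : realType) (n : nat) (Ta Tb : Type) (A : Tb -> Ta -> 'M[R]_n) (M : 'M[R]_n).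
Variables (a0 : Ta) (b0 : Tb) (K : R).
Hypothesis bounded : forall b a, `|\tr (A b a *m M)| <= K.

Let val b := range (fun a => \tr (A b a *m M)).

Let val_n0 b : val b !=set0. Proof. by exists (\tr (A b a0 *m M)), a0. Qed.

Let val_lb b : has_lbound (val b).
Proof.
exists (- K) => _ [a _ <-].
by have := bounded b a; rewrite ler_norml => /andP[].
Qed.

(** The bound [K] ensures that [inf] and [sup] are genuine and not default values; the infimum for
    the given [b] is already nonnegative. *)
Lemma isaacs_ge0 b : (forall a, 0 <= \tr (A b a *m M)) -> 0 <= isaacs A M.
Proof.
move=> pos; apply: (@le_trans _ _ (inf (val b))).
  by apply: lb_le_inf => // _ [a _ <-].
apply: ub_le_sup; last by exists b.
exists K => _ [b' _ <-]; apply: (@le_trans _ _ (\tr (A b' a0 *m M))).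
  by apply: (ge_inf (val_lb b')); exists a0.
by have := bounded b' a0; rewrite ler_norml => /andP[].
Qed.

Lemma isaacs_le0 : (forall b, exists a, \tr (A b a *m M) <= 0) -> isaacs A M <= 0.
Proof.
move=> neg; apply: ge_sup; first by exists (inf (val b0)), b0.
move=> _ [b _ <-]; have [a ha] := neg b.
by apply: le_trans ha; apply: (ge_inf (val_lb b)); exists a.
Qed.

End Isaacs.

(** * Viscosity inequalities for the homogeneous quotient *)

Section Viscosity.
Variables (R : realType) (n : nat) (Phi : 'rV[R]_n -> 'rV[R]_n -> 'rV[R]_n -> R).
Variable delta : R.
Implicit Types (p q v x y z : 'rV[R]_n).
Hypothesis PhiD : forall x x' y z, Phi (x + x') y z = Phi x y z + Phi x' y z.
Hypothesis PhiZ : forall (a : R) x y z, Phi (a *: x) y z = a * Phi x y z.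
Hypothesis PhiC12 : forall x y z, Phi x y z = Phi y x z.
Hypothesis PhiC23 : forall x y z, Phi x y z = Phi x z y.
Hypothesis cubic_bound : forall x, 27 * cubic Phi x ^+ 2 <= dot x x ^+ 3.
Hypothesis delta_ge0 : 0 <= delta.
Hypothesis delta_lt2 : delta < 2.
Hypothesis Phi_large : forall v a b (T0 eps : R), 0 < eps -> 0 <= T0 ->
  dot v v <= 3 * T0 ^+ 2 -> T0 ^+ 3 - dot v v * T0 + 2 * cubic Phi v <= 0 ->
  exists z, [/\ z != 0, dot z a = 0, dot z b = 0 & (T0 - eps) * dot z z <= Phi v z z].

Local Notation cubic := (cubic Phi).
Local Notation nhess := (nhess Phi delta).

Definition hom_cubic x := cubic x / enorm x `^ delta.
Local Notation u := hom_cubic.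

Lemma enorm_powR x : enorm x `^ delta = dot x x `^ (delta / 2).
Proof. by rewrite enorm_dot -powR12_sqrt ?dot_ge0// -powRrM mulrC. Qed.

Lemma hom_cubicE x : u x = cubic x * dot x x `^ (- (delta / 2)).
Proof. by rewrite /u enorm_powR powRN. Qed.

Lemma hom_cubicN x : u (- x) = - u x.
Proof. by rewrite !hom_cubicE (cubicN PhiZ PhiC12 PhiC23) dotNl dotNr opprK mulNr. Qed.

Lemma hom_cubic0 : u 0 = 0.
Proof. by rewrite hom_cubicE cubic0// mul0r. Qed.

Lemma hom_cubic_line x z : x != 0 ->
  exists2 g : R -> R,
    (\forall t \near (0 : R), is_derive (t : R) 1 (fun t : R => u (x + t *: z)) (g t)) &
    is_derive (0 : R) 1 g (qform ((enorm x `^ delta)^-1 *: nhess x) z).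
Proof.
move=> x0; have D0 := dot_gt0 x0.
have [g g1 g2] := second_derivative_cubic_pow (cubic x) (Phi x x z / 2) (Phi x z z / 2)
  (cubic z) (2 * dot x z) (dot z z) (- (delta / 2)) D0.
exists g.
  have -> : (fun t : R => u (x + t *: z)) = (fun t => (cubic x + Phi x x z / 2 * t +
      Phi x z z / 2 * t ^+ 2 + cubic z * t ^+ 3) *
      (dot x x + 2 * dot x z * t + dot z z * t ^+ 2) `^ (- (delta / 2))).
    by apply/funext => t; rewrite hom_cubicE cubic_line// dot_line.
  exact: g1.
apply: (is_derive_eq g2).
rewrite qformZ qform_nhess// enorm_powR -powRN; congr (_ * _).
by rewrite /cubic_quot; field; rewrite gt_eqF.
Qed.

(** The sign [e = 1] serves subsolutions, [e = - 1] supersolutions. Away from the origin second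
    derivatives are compared along each line through [x]. *)
Lemma touching (U : set 'rV[R]_n) (phi : 'rV[R]_n -> R) x (e : R) :
  open U -> C2_on U phi -> U x ->
  (\forall y \near x, e * (u y - phi y) <= e * (u x - phi x)) ->
  forall z, 0 <= e * (qform (hessian phi x) z - qform ((enorm x `^ delta)^-1 *: nhess x) z).
Proof.
move=> Uo Cphi Ux emax z.
have cl (w : 'rV[R]_n) : {for 0, continuous (fun t : R => x + t *: w)}.
  by apply: cvgD; [exact: cvg_cst|exact: scalel_continuous].
have near_line (w : 'rV[R]_n) : \forall t \near (0 : R),
    e * (u (x + t *: w) - phi (x + t *: w)) <= e * (u x - phi x).
  have := cl w [set y | e * (u y - phi y) <= e * (u x - phi x)].
  by rewrite scale0r addr0; exact.
have [x0|x0] := eqVneq x 0; last first.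
  have [g g1 g2] := C2_line z Uo Cphi Ux.
  have [k k1 k2] := hom_cubic_line z x0.
  rewrite -oppr_le0 -mulrN opprB.
  apply: (@second_derivative_max _ (fun t => e * (u (x + t *: z) - phi (x + t *: z)))
    (fun t => e * (k t - g t)) _ _ (is_deriveZ e (is_deriveB k2 g2))).
  - near=> t.
    have d1 : is_derive t 1 (fun t : R => u (x + t *: z)) (k t) by near: t.
    have d2 : is_derive t 1 (fun t : R => phi (x + t *: z)) (g t) by near: t.
    exact: (is_deriveZ e (is_deriveB d1 d2)).
  - by apply: filterS (near_line z) => t; rewrite scale0r addr0.
(* At the origin, adding the inequalities along [z] and [- z] cancels the odd function [u], so
   [- e (phi(t z) + phi(- t z))] has a maximum at [t = 0]. *)
rewrite x0 nhess0// scaler0 [qform 0 z](_ : _ = 0) ?subr0; last first.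
  by rewrite /qform mulmx0 mul0mx mxE.
rewrite x0 in Ux near_line.
have [g g1 g2] := C2_line z Uo Cphi Ux.
have [k k1 k2] := C2_line (- z) Uo Cphi Ux.
have qN : qform (hessian phi 0) (- z) = qform (hessian phi 0) z.
  by rewrite -scaleN1r qformZv sqrrN expr1n mul1r.
rewrite qN in k2.
suff : - e * (qform (hessian phi 0) z + qform (hessian phi 0) z) <= 0 by lra.
apply: (@second_derivative_max _ (fun t => - e * (phi (0 + t *: z) + phi (0 + t *: - z)))
    (fun t => - e * (g t + k t)) _ _ (is_deriveZ (- e) (is_deriveD g2 k2))).
- near=> t.
  have d1 : is_derive t 1 (fun t : R => phi (0 + t *: z)) (g t) by near: t.
  have d2 : is_derive t 1 (fun t : R => phi (0 + t *: - z)) (k t) by near: t.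
  exact: (is_deriveZ (- e) (is_deriveD d1 d2)).
- apply: filterS2 (near_line z) (near_line (- z)) => t.
  rewrite !scale0r !addr0 !add0r scalerN hom_cubicN hom_cubic0; lra.
Unshelve. all: by end_near. Qed.

Lemma dot_continuous : continuous (fun x => dot x x : R).
Proof.
apply: continuous_big => [|i _ x]; first exact: add_continuous.
by apply: continuousM; exact: coord_continuous.
Qed.

Lemma cubic_continuous : continuous cubic.
Proof.
have -> : cubic = (fun x => (\sum_i \sum_j x 0 i * x 0 j *
    Phi x (delta_mx 0 i) (delta_mx 0 j)) * 6^-1).
  apply/funext => x; rewrite /cubic -qform_Phi_mx// qformE; congr (_ / _).
  by apply: eq_bigr => i _; apply: eq_bigr => j _; rewrite mxE.
suff c : continuous (fun x => \sum_i \sum_j x 0 i * x 0 j *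
    Phi x (delta_mx 0 i) (delta_mx 0 j) : R) by move=> x; exact: (cvgM (c x) (cvg_cst _)).
apply: continuous_big => [|i _]; first exact: add_continuous.
apply: continuous_big => [|j _ y]; first exact: add_continuous.
have cc k : (fun x => x 0 k) @ y --> y 0 k by exact: coord_continuous.
apply: (cvgM (cvgM (cc i) (cc j))).
by apply: functional_continuous => [x' y'|a x']; [exact: PhiD|exact: PhiZ].
Qed.

Lemma unit_ball_open : open (@unit_ball R n).
Proof.
have E x : (enorm x < 1) = (dot x x < 1) by rewrite enorm_dot -{1}sqrtr1 ltr_sqrt.
have -> : @unit_ball R n = (fun x => dot x x) @^-1` [set t | t < 1].
  by apply/seteqP; split => x; rewrite /unit_ball /= E.
exact: ((continuousP _).1 dot_continuous _ (@open_lt R 1)).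
Qed.

(** In the unit ball [|x|^3 / |x|^delta <= |x|] because [delta <= 2]; this gives continuity at the
    origin. *)
Lemma hom_cubic_le x : enorm x <= 1 -> `|u x| <= enorm x.
Proof.
move=> x1; have [->|x0] := eqVneq x 0.
  by rewrite hom_cubic0 normr0 sqrtr_ge0.
have e0 : 0 < enorm x by rewrite enorm_dot sqrtr_gt0 dot_gt0.
rewrite /u normrM normfV ler_pdivrMr ?normr_gt0 ?gt_eqF ?powR_gt0//.
rewrite (ger0_norm (powR_ge0 _ _)).
apply: le_trans (cubic_abs_le cubic_bound x) _.
rewrite exprS ler_pM2l//.
have a01 : 0 < enorm x <= 1 by rewrite e0.
have h := ger_powR a01 (ltW delta_lt2); rewrite (powR_mulrn 2 (ltW e0)) in h.
exact: h.
Qed.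

Lemma hom_cubic_cvg0 : u y @[y --> (0 : 'rV[R]_n)] --> (0 : R).
Proof.
refine ((cvgrPdist_lt (FF := nbhs_filter (0 : 'rV[R]_n)) _ _).2 _) => e e0.
have m0 : 0 < Num.min 1 e ^+ 2 by rewrite exprn_gt0// lt_min ltr01.
have : \forall y \near (0 : 'rV[R]_n), dot y y < Num.min 1 e ^+ 2.
  by apply: (cvgr_lt (dot 0 0) (@dot_continuous 0)); rewrite dot0l.
apply: filterS => y; rewrite -enorm_sqr ltr_sqr ?nnegrE ?sqrtr_ge0//; last first.
  by rewrite le_min ler01 ltW.
rewrite lt_min sub0r normrN => /andP[y1 ye].
by apply: le_lt_trans ye; rewrite hom_cubic_le// ltW.
Qed.

Lemma hom_cubic_continuous : continuous u.
Proof.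
move=> x; have [->|x0] := eqVneq x 0; last first.
  have -> : u = (fun x => cubic x * dot x x `^ (- (delta / 2))).
    by apply/funext => y; exact: hom_cubicE.
  have cp : {for dot x x, continuous (fun t : R => t `^ (- (delta / 2)))}.
    apply/differentiable_continuous; rewrite -derivable1_diffP.
    by case: (is_derive1_powR (- (delta / 2)) (dot_gt0 x0)).
  have c2 : {for x, continuous ((fun t : R => t `^ (- (delta / 2))) \o (fun y => dot y y))}.
    by apply: continuous_comp; [exact: dot_continuous|exact: cp].
  exact: (cvgM (@cubic_continuous x) c2).
by rewrite /continuous_at hom_cubic0; exact: hom_cubic_cvg0.
Qed.

Theorem hom_cubic_isaacs : isaacs_visc_sol (@unit_ball R n) u.
Proof.
have [L L0 hL] := exists_elliptic_null PhiD PhiZ PhiC12 PhiC23 cubic_bound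
  delta_ge0 delta_lt2 Phi_large.
have [B BP] := choice (fun ab : 'rV[R]_n * 'rV[R]_n => hL ab.1 ab.2).
pose A (b a : 'rV[R]_n) : 'M[R]_n := 1%:M + B (a, b).
have Adual b a : psd_dual (A b a).
  by apply: psd_dualD; [exact: psd_dual1|have [] := BP (a, b)].
have Anull1 b a : \tr (A b a *m nhess a) = 0 by have [] := BP (a, b).
have Anull2 b a : \tr (A b a *m nhess b) = 0 by have [] := BP (a, b).
have bounded M b a : `|\tr (A b a *m M)| <= \sum_i \sum_j (1 + L) * `|M j i|.
  rewrite /mxtrace; apply: le_trans (ler_norm_sum _ _ _) _; apply: ler_sum => i _.
  rewrite mxE; apply: le_trans (ler_norm_sum _ _ _) _; apply: ler_sum => j _.
  rewrite normrM ler_wpM2r// /A mxE; apply: le_trans (ler_normD _ _) _.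
  have [pB tB _ _] := BP (a, b).
  apply: lerD; last exact: le_trans (psd_dual_entry _ _ pB) tB.
  by rewrite mxE; case: eqP => _; rewrite ?mulr1n ?mulr0n ?normr1 ?normr0.
exists 'rV[R]_n, 'rV[R]_n, A, (1 + L); split; first exact: (inhabits 0).
split; first exact: (inhabits 0).
split.
  split; first by rewrite ltr_pwDl.
  move=> b a; split; first by case: (Adual b a).
  move=> xi; have [pB tB _ _] := BP (a, b); rewrite -/(qform _ _) qformD qform1 enorm_sqr.
  have /andP[q0 q1] := psd_dual_bounds xi pB; have d0 := dot_ge0 xi.
  have q2 : \tr (B (a, b)) * dot xi xi <= L * dot xi xi by rewrite ler_wpM2r.
  apply/andP; split; last by lra.
  apply: (@le_trans _ _ (dot xi xi)); last by lra.
  by rewrite -{2}[dot xi xi]mul1r ler_wpM2r// invf_le1 ?lerDl// ltr_pwDl.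
have trH b a x : \tr (A b a *m nhess x) = 0 ->
    \tr (A b a *m ((enorm x `^ delta)^-1 *: nhess x)) = 0.
  by move=> h; rewrite -scalemxAr mxtraceZ h mulr0.
have trB b a M x : \tr (A b a *m nhess x) = 0 ->
    \tr (A b a *m (M - (enorm x `^ delta)^-1 *: nhess x)) = \tr (A b a *m M).
  by move=> h; rewrite mulmxBr linearB /= trH// subr0.
split; split; try by move=> x _; exact: hom_cubic_continuous.
- move=> phi x Cphi Ux xmax.
  have psdD : psd (hessian phi x - (enorm x `^ delta)^-1 *: nhess x).
    move=> z; rewrite qformD qformN.
    have h : \forall y \near x, 1 * (u y - phi y) <= 1 * (u x - phi x).
      by apply: filterS xmax => y; rewrite !mul1r.
    by have := touching unit_ball_open Cphi Ux h z; rewrite mul1r.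
  (* With [b = x] every operator annihilates the Hessian of [u] at [x], so only the semidefinite
     difference contributes. *)
  apply: (isaacs_ge0 0 (bounded _) (b := x)) => a.
  by rewrite -(trB _ _ _ _ (Anull2 x a)); apply: (Adual x a).2.
- move=> phi x Cphi Ux xmin.
  have psdD : psd (- (hessian phi x - (enorm x `^ delta)^-1 *: nhess x)).
    move=> z; rewrite qformN qformD qformN.
    have h : \forall y \near x, - 1 * (u y - phi y) <= - 1 * (u x - phi x).
      by apply: filterS xmin => y; rewrite !mulN1r lerN2.
    by have := touching unit_ball_open Cphi Ux h z; rewrite mulN1r.
  (* Against any [b] the choice [a = x] annihilates the Hessian of [u] at [x]. *)
  apply: (isaacs_le0 0 (bounded _)) => b; exists x.
  rewrite -(trB _ _ _ _ (Anull1 b x)) -oppr_ge0 -linearN /= -mulmxN.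
  exact: (Adual b x).2.
Qed.

End Viscosity.

(* Q has orthonormal rows: y |-> y *m Q is a linear isometry of R^21 onto the
   21-dimensional subspace H' = its image; every (H', identification) arises so. *)
Theorem theorem1p2 (R : realType) (delta : R) (Q : 'M[R]_(21, 24)) :
  1 <= delta -> delta < 2 ->
  Q *m Q^T = 1%:M ->
  isaacs_visc_sol (@unit_ball R 21)
    (fun y : 'rV[R]_21 => P24 (y *m Q) / (enorm (y *m Q)) `^ delta).
Proof.
move=> delta1 delta2 QQ.
pose Phi (x y z : 'rV[R]_21) := P24_tri (x *m Q) (y *m Q) (z *m Q).
have cubicE x : cubic Phi x = P24 (x *m Q) by rewrite /cubic /Phi P24_triE; field.
have -> : (fun y => P24 (y *m Q) / enorm (y *m Q) `^ delta) = hom_cubic Phi delta.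
  by apply/funext => y; rewrite /hom_cubic cubicE !enorm_dot dot_isometry.
apply: hom_cubic_isaacs => //.
- by move=> x x' y z; rewrite /Phi mulmxDl P24_triD.
- by move=> a x y z; rewrite /Phi -scalemxAl P24_triZ.
- by move=> x y z; exact: P24_triC12.
- by move=> x y z; exact: P24_triC23.
- by move=> x; rewrite cubicE -(dot_isometry QQ); exact: P24_bound.
- exact: le_trans ler01 delta1.
- by move=> v a b T0 eps eps0 T00 vT; rewrite cubicE; exact: P24_large_on_subspace.
Qed.
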